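(* Let $S=\operatorname{Spec} R$ be a noetherian affine scheme. Let $T:=T_1\cup\dots\cup T_m$ be a finite union of pro-constructible subsets of $\mathbb{A}^N_S$. Suppose that: (1) There exists an open subset $V\subseteq S$ with zero-dimensional (possibly empty) complement such that for all $i\le m$, $\dim(T_i\cap\mathbb{A}^N_V)<N$ and $(T_i)_s$ is constructible in $\mathbb{A}^N_{k(s)}$ for all $s\in V$. (2) For all $s\in S$, there exists a $k(s)$-rational point in $\mathbb{A}^N_{k(s)}$ which does not belong to $T_s$. Then there exists a section $\sigma$ of the structure morphism $\pi:\mathbb{A}^N_S\to S$ such that $\sigma(S)\cap T=\emptyset$.
   Context: A pro-constructible subset of a noetherian scheme is a (possibly infinite) intersection of constructible subsets. The dimension of a subset of a topological space is the Krull dimension of the subset with the induced topology; $\dim\emptyset<0$. For a subset $T\subseteq\mathbb{A}^N_S$ and $s\in S$, $T_s:=\pi^{-1}(s)\cap T$, viewed as a subset of the fiber $\mathbb{A}^N_{k(s)}$, where $k(s)$ is the residue field of $s$. *)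

(* Defs.v *)
From HB Require Import structures.
From mathcomp Require Import all_boot all_order all_algebra.
From mathcomp Require Import ring_quotient fraction generic_quotient.
From mathcomp Require Import boolp classical_sets constructive_ereal topology.
(* The notations of [mpoly] clash with those of the analysis library. *)
From mathcomp Require Import(canonicals) mpoly.

Set Implicit Arguments.
Unset Strict Implicit.
Unset Printing Implicit Defensive.

Import Order.TTheory GRing.Theory Num.Theory.
Local Open Scope classical_set_scope.
Local Open Scope ring_scope.

Section Topology.
Variable X : topologicalType.

Definition irreducible (Z : set X) : Prop :=
  Z !=set0 /\
  forall C D : set X, closed C -> closed D ->
    Z `<=` C `|` D -> Z `<=` C \/ Z `<=` D.

Definition irreducible_chain (n : nat) (Z : nat -> set X) : Prop :=
  (forall i, (i <= n)%N -> closed (Z i) /\ irreducible (Z i)) /\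
  (forall i, (i < n)%N -> Z i `<` Z i.+1).

(* The supremum is taken in Z extended by -oo and +oo; it is -oo for the empty
   space, and +oo when the lengths of chains are unbounded. *)
Definition krull_dim : \bar int :=
  supremum -oo%E
    [set (n%:Z)%:E | n in [set n : nat | exists Z, irreducible_chain n Z]].

(* Finite unions of locally closed subsets. This is the general notion only
   when X is noetherian, which holds for all the spaces it is used on. *)
Definition constructible (A : set X) : Prop :=
  exists (n : nat) (U C : 'I_n -> set X),
    (forall i, open (U i) /\ closed (C i)) /\
    A = \bigcup_i (U i `&` C i).

Definition pro_constructible (A : set X) : Prop :=
  exists F : set (set X),
    (forall B, F B -> constructible B) /\ A = \bigcap_(B in F) B.

End Topology.

(* [set_type A] carries the induced topology. *)
Definition subset_dim (X : topologicalType) (A : set X) : \bar int :=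
  krull_dim (set_type A).

Section NoetherianRing.
Variable R : comNzRingType.

Definition is_ideal (I : set R) : Prop :=
  [/\ I 0, forall x y, I x -> I y -> I (x + y)
    & forall a x, I x -> I (a * x)].

Definition noetherian : Prop :=
  forall I : set R, is_ideal I ->
    exists (n : nat) (g : 'I_n -> R),
      I = [set x | exists c : 'I_n -> R, x = \sum_i c i * g i].

End NoetherianRing.

Definition Spec (R : comNzRingType) : Type := prime_idealr R.

Section ZariskiTopology.
Variable R : comNzRingType.

Definition zero_locus (E : set R) : set (Spec R) :=
  [set p : Spec R | forall x, E x -> x \in p].

Definition zariski_open : set (set (Spec R)) :=
  [set U | exists E : set R, U = ~` zero_locus E].

Lemma zariski_openT : zariski_open setT.
Proof.
exists setT; apply/seteqP; split => // p _ /(_ 1 I).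
by rewrite idealr1.
Qed.

Lemma zariski_openI : setI_closed zariski_open.
Proof.
move=> _ _ [E ->] [F ->].
exists [set z | exists x y, [/\ E x, F y & z = x * y]].
rewrite -setCU; congr (~` _); apply/seteqP; split => p.
  case=> [pE|pF] z [x [y [Ex Fy ->]]].
    by rewrite prime_idealrM (pE _ Ex).
  by rewrite prime_idealrM (pF _ Fy) orbT.
move=> pEF; have [pE|] := pselect (zero_locus E p); first by left.
move=> /existsNP[x /not_implyP[Ex px]]; right => y Fy.
have : x * y \in p by apply: pEF; exists x, y.
by rewrite prime_idealrM => /orP[/px|].
Qed.

Lemma zariski_open_bigcup (I : Type) (U : I -> set (Spec R)) :
  (forall i, zariski_open (U i)) -> zariski_open (\bigcup_i U i).
Proof.
move=> /choice[E UE]; exists (\bigcup_i E i).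
apply/seteqP; split => [p|p].
  by move=> [i _]; rewrite UE => npE pE; apply: npE => x Ex; apply: pE; exists i.
move=> /existsNP[x /not_implyP[[i _ Ex] px]]; exists i => //.
by rewrite UE => /(_ x Ex).
Qed.

HB.instance Definition _ := gen_eqMixin (Spec R).
HB.instance Definition _ := gen_choiceMixin (Spec R).
HB.instance Definition _ := isOpenTopological.Build (Spec R)
  zariski_openT zariski_openI zariski_open_bigcup.

End ZariskiTopology.

Section SpecMap.
Variables (A B : comNzRingType) (f : {rmorphism A -> B}) (q : Spec B).

Definition preimage_ideal : A -> bool := fun x => f x \in q.

Let in_preimage_ideal x : (x \in preimage_ideal) = (f x \in q).
Proof. by []. Qed.

Lemma preimage_ideal_idealr : idealr_closed preimage_ideal.
Proof.
split=> [||a x y]; rewrite !in_preimage_ideal ?rmorph0 ?rmorph1 ?idealr0 //.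
  by rewrite idealr1.
by rewrite rmorphD rmorphM => qx qy; rewrite rpredD ?idealMr.
Qed.

Lemma preimage_ideal_prime : prime_idealr_closed preimage_ideal.
Proof. by move=> x y; rewrite !in_preimage_ideal rmorphM prime_idealrM. Qed.

HB.instance Definition _ := isIdealr.Build A preimage_ideal preimage_ideal_idealr.
HB.instance Definition _ :=
  isPrimeIdealrClosed.Build A preimage_ideal preimage_ideal_prime.

Definition spec_map : Spec A := preimage_ideal : prime_idealr A.

End SpecMap.

Section ResidueField.
Variables (R : comNzRingType) (p : Spec R).

Definition residue_domain : Type := {ideal_quot p}.

HB.instance Definition _ := GRing.ComNzRing.on residue_domain.

Let unit : {pred residue_domain} := fun x => `[< exists y, y * x = 1 >].
Let inv (x : residue_domain) : residue_domain :=
  if pselect (exists y, y * x = 1) is left h then sval (cid h) else x.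

Let mulVx : {in unit, left_inverse 1 inv *%R}.
Proof.
by move=> x /asboolP ux; rewrite /inv; case: pselect => // h; case: cid.
Qed.

Let unitP (x y : residue_domain) : y * x = 1 -> x \in unit.
Proof. by move=> yx; apply/asboolP; exists y. Qed.

Let inv_out : {in [predC unit], inv =1 id}.
Proof. by move=> x /asboolPn nux; rewrite /inv; case: pselect. Qed.

HB.instance Definition _ :=
  GRing.ComNzRing_hasMulInverse.Build residue_domain mulVx unitP inv_out.

Let mulf_eq0 (x y : residue_domain) : x * y = 0 -> (x == 0) || (y == 0).
Proof. exact: (@Quotient.rquot_IdomainAxiom R p). Qed.

HB.instance Definition _ :=
  GRing.ComUnitRing_isIntegral.Build residue_domain mulf_eq0.

Definition residue_field : fieldType := {fraction residue_domain}.

Definition to_residue_domain : {rmorphism R -> residue_domain} :=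
  \pi_{ideal_quot p}%qT.

Definition to_residue_field : {rmorphism R -> residue_field} :=
  @tofrac residue_domain \o to_residue_domain.

End ResidueField.

Section AffineSpace.
Variable N : nat.

Definition affine_space (R : comNzRingType) : topologicalType :=
  Spec (mpoly.mpoly N R).

Definition structure_map (R : comNzRingType) : affine_space R -> Spec R :=
  spec_map (@mpoly.mpolyC N R).

(* The canonical map A^N_{k(s)} -> A^N_R, a homeomorphism onto the fiber of
   the structure morphism over s. *)
Definition fiber_map (R : comNzRingType) (s : Spec R) :
    affine_space (residue_field s) -> affine_space R :=
  spec_map (mpoly.map_mpoly (to_residue_field s)).

Arguments structure_map {R}.
Arguments fiber_map {R} s.

Definition fiber (R : comNzRingType) (T : set (affine_space R)) (s : Spec R) :
    set (affine_space (residue_field s)) :=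
  fiber_map s @^-1` (structure_map @^-1` [set s] `&` T).

Arguments fiber {R} T s.

(* The residue field of q is k itself. *)
Definition rational_point (k : fieldType) (q : affine_space k) : Prop :=
  forall z : residue_field q, exists c : k,
    z = to_residue_field q (mpoly.mpolyC N c).

(* Morphisms of affine schemes Spec B -> Spec A are the ring morphisms A -> B,
   so that a section of the structure morphism A^N_R -> Spec R is a ring
   morphism R[x_1, ..., x_N] -> R which restricts to the identity on R. *)
Definition is_section (R : comNzRingType)
    (sigma : {rmorphism mpoly.mpoly N R -> R}) : Prop :=
  forall c : R, sigma (mpoly.mpolyC N c) = c.

End AffineSpace.

Arguments structure_map {N R}.
Arguments fiber_map {N R} s.
Arguments fiber {N R} T s.

(* Main.v *)
Require Import Defs.
From HB Require Import structures.
From mathcomp Require Import all_boot all_order all_algebra.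
From mathcomp Require Import ring_quotient fraction generic_quotient.
From mathcomp Require Import boolp classical_sets constructive_ereal topology.
From mathcomp Require Import zify.
From mathcomp Require Import(canonicals) mpoly.

(** A section of the affine space over Spec R is a point c of R^n. It avoids T
when, for every prime s, the set of the f with f(c) in s, which is the prime
ideal [rat_point c s], does not belong to T. The coordinates of c are found by
induction on n ([exists_avoiding_point]): T is cut by a hypersurface which is
itself an affine space, the graph x_n = g(x_0, ..., x_(n-1)) + a. The induction
carries a finite set L of maximal ideals of R such that, over the other primes,
no T_i contains a chain of points of length n or the generic point of a fiber;
and, at every maximal ideal, the existence of a point of R^n avoiding T there.
Each cut ([hypersurface_step]) has to preserve these properties.

The lengths of chains drop when the graph passes through no minimal point of any
T_i. There are finitely many minimal points ([patch_closed_basis]), and each of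
them forbids at most one coset of values of a, modulo the prime below it. If
this prime has a finite residue ring, it is maximal and is put into L. The
remaining cosets have infinite index, and can be avoided while a is prescribed
modulo the members of L ([chinese_maximal], [exists_avoid_cosets]). Over L,
prescribing a amounts to cutting through a point which avoids T.

Away from L the cut fibers must still miss a rational point, and this is where
small residue fields are an obstacle. The fiber T_s lies in a hypersurface of
degree less than d in each variable, with the same d for all s outside L
([fibers_bounded_degree]). If the graph lay in such a hypersurface, T could
cover all of its rational points. With g = x_0 ^ (d ^ n) its degree is too large
for that, for every a: a curve drawn on the graph meets the hypersurface in
fewer than d ^ (n + 1) points ([exists_nonzero_on_curve]). So only the primes
with fewer residues are in danger. They are finitely many
([few_residues_finite]) and do not depend on a, hence they can be put into L
before a is chosen.

All these finiteness properties are instances of one principle of noetherian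
induction on the spectrum, [spec_ind]. The only property of T which they use is
[patch_closed]: pro-constructible sets have it, and it is inherited by
preimages.

To start the induction, the zero-dimensional complement of V is a finite set of
maximal ideals ([zero_dim_closed_maximal]). If the constructible fiber T_s
contains the generic point, it contains a non-empty open set. When the residue
ring of s is infinite, this open set contains a rational point at the end of a
chain of length n ([full_fiber_chain]), against the bound on the dimension.
Hence R / s is finite and s is maximal; there are finitely many such s
([full_fibers_finite]), and together with the complement of V they form the
first set L. *)

Set Implicit Arguments.
Unset Strict Implicit.
Unset Printing Implicit Defensive.

Import Order.TTheory GRing.Theory Num.Theory.
Local Open Scope classical_set_scope.
Local Open Scope ring_scope.

Local Notation mpoly := mpoly.mpoly.
Local Notation mpolyC := mpoly.mpolyC.
Local Notation mvar i := (mpoly.mpolyX _ (mpoly.mnm1 i)).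

(** * Noetherian rings *)

Section Noetherian.
Variable R : comNzRingType.
Implicit Types (I : set R) (a : nat -> R).

Lemma ideal_sum I n (c g : nat -> R) :
  is_ideal I -> (forall i, (i < n)%N -> I (g i)) -> I (\sum_(i < n) c i * g i).
Proof.
by case=> I0 ID IM Ig; apply: (big_ind (fun x => I x)) => // i _; apply/IM/Ig.
Qed.

Definition ideal_span a k : set R :=
  [set x | exists c : nat -> R, x = \sum_(i < k) c i * a i].

Lemma ideal_span_is_ideal a k : is_ideal (ideal_span a k).
Proof.
split=> [|_ _ [c ->] [d ->]|b _ [c ->]].
- by exists (fun=> 0); rewrite big1 // => i _; rewrite mul0r.
- exists (fun i => c i + d i); rewrite -big_split /=.
  by apply: eq_bigr => i _; rewrite mulrDl.
- exists (fun i => b * c i); rewrite big_distrr /=.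
  by apply: eq_bigr => i _; rewrite mulrA.
Qed.

Lemma ideal_span_mem a k i : (i < k)%N -> ideal_span a k (a i).
Proof.
move=> ik; exists (fun j => (j == i)%:R).
rewrite (bigD1 (Ordinal ik)) //= eqxx mul1r big1 ?addr0 // => j.
by rewrite -val_eqE /= => /negPf ->; rewrite mul0r.
Qed.

Lemma ideal_span_sub a k I :
  is_ideal I -> (forall i, (i < k)%N -> I (a i)) -> ideal_span a k `<=` I.
Proof. by move=> idI Ia _ [c ->]; exact: (ideal_sum c idI Ia). Qed.

Lemma ideal_span_le a j k : (j <= k)%N -> ideal_span a j `<=` ideal_span a k.
Proof.
move=> jk; apply: ideal_span_sub; first exact: ideal_span_is_ideal.
by move=> i ij; apply/ideal_span_mem/(leq_trans ij).
Qed.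

Lemma eq_ideal_span a b k :
  (forall i, (i < k)%N -> a i = b i) -> ideal_span a k = ideal_span b k.
Proof.
move=> ab; apply/seteqP; split => _ [c ->]; exists c;
  by apply: eq_bigr => i _; rewrite ab.
Qed.

(** The ascending chain condition.  The ideal generated by the whole sequence is
generated by finitely many elements, hence by an initial segment of the
sequence, which then generates the next term. *)
Lemma noetherian_stationary a : noetherian R -> exists k, ideal_span a k (a k).
Proof.
move=> noethR; have [|n [g Ug]] := noethR [set x | exists k, ideal_span a k x].
  split=> [|x y [j xj] [k yk]|b x [k xk]].
  - by exists 0%N; case: (ideal_span_is_ideal a 0).
  - exists (maxn j k); case: (ideal_span_is_ideal a (maxn j k)) => _ + _; apply.
      exact: ideal_span_le (leq_maxl _ _) _ xj.
    exact: ideal_span_le (leq_maxr _ _) _ yk.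
  - by exists k; case: (ideal_span_is_ideal a k) => _ _; apply.
have /choice[k gk] (i : 'I_n) : exists k, ideal_span a k (g i).
  suff : [set x | exists k, ideal_span a k x] (g i) by [].
  rewrite Ug; exists (fun j => (j == i)%:R).
  rewrite (bigD1 i) //= eqxx mul1r big1 ?addr0 // => j.
  by move=> /negPf ->; rewrite mul0r.
exists (\max_i k i)%N; set K := (\max_i k i)%N.
have : [set x | exists k, ideal_span a k x] (a K).
  by exists K.+1; apply: ideal_span_mem.
rewrite Ug => -[c ->]; have [s0 sD sM] := ideal_span_is_ideal a K.
apply: (big_ind (fun x => ideal_span a K x)) => // i _; apply: sM.
by apply: ideal_span_le (gk i); apply: leq_bigmax.
Qed.

(** A counterexample would start a strictly increasing sequence of
counterexamples, and elements chosen in the successive differences would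
contradict the ascending chain condition. *)
Lemma noetherian_ideal_ind (P : set R -> Prop) : noetherian R ->
  (forall I, is_ideal I ->
    (forall J, is_ideal J -> I `<=` J -> ~ J `<=` I -> P J) -> P I) ->
  forall I, is_ideal I -> P I.
Proof.
move=> noethR step I idI; apply: contrapT => nPI.
pose bad := {J : set R | is_ideal J /\ ~ P J}.
have /choice[next nextP] (J : bad) : exists K : bad * R,
    [/\ sval J `<=` sval K.1, sval K.1 K.2 & ~ sval J K.2].
  case: J => J [idJ nPJ] /=; apply: contrapT => nex; apply/nPJ/step => // K idK.
  move=> JK /existsNP[x /not_implyP[Kx nJx]]; apply: contrapT => nPK.
  apply: nex.
  by exists (exist _ K (conj idK nPK), x).
pose chain n : bad := iter n (fun J => (next J).1) (exist _ I (conj idI nPI)).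
have chain_le j k : (j <= k)%N -> sval (chain j) `<=` sval (chain k).
  elim: k => [|k IHk]; first by rewrite leqn0 => /eqP ->.
  rewrite leq_eqVlt ltnS => /predU1P[-> //|/IHk]; move/subset_trans; apply.
  by rewrite [chain k.+1]iterS; case: (nextP (chain k)).
have [k] := noetherian_stationary (fun n => (next (chain n)).2) noethR.
case: (nextP (chain k)) => _ _; apply: contra_not; apply: ideal_span_sub.
  by case: (svalP (chain k)).
move=> i ik; apply: (chain_le i.+1 k ik).
by rewrite [chain i.+1]iterS; case: (nextP (chain i)).
Qed.

Definition adjoin I x : set R :=
  [set z | exists2 i, I i & exists b, z = i + b * x].

Lemma adjoin_ideal I x : is_ideal I -> is_ideal (adjoin I x).
Proof.
case=> I0 ID IM; split=> [|_ _ [i Ii [b ->]] [j Ij [c ->]]|c _ [i Ii [b ->]]].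
- by exists 0 => //; exists 0; rewrite mul0r addr0.
- by exists (i + j); [exact: ID|exists (b + c); rewrite mulrDl addrACA].
- by exists (c * i); [exact: IM|exists (c * b); rewrite mulrDr mulrA].
Qed.

Lemma sub_adjoin I x : I `<=` adjoin I x.
Proof. by move=> i Ii; exists i => //; exists 0; rewrite mul0r addr0. Qed.

Lemma adjoin_mem I x : is_ideal I -> adjoin I x x.
Proof. by case=> I0 _ _; exists 0 => //; exists 1; rewrite mul1r add0r. Qed.

End Noetherian.

Section PrimeOfSet.
Variables (R : comNzRingType) (I : set R).
Hypotheses (idI : is_ideal I) (properI : ~ I 1).
Hypothesis (primeI : forall x y, I (x * y) -> I x \/ I y).

Let mem : R -> bool := fun x => `[< I x >].

Let mem_idealr : idealr_closed mem.
Proof.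
case: idI => I0 ID IM; split=> [||a x y].
- exact/asboolP.
- exact/asboolPn.
- by move=> /asboolP Ix /asboolP Iy; apply/asboolP/ID => //; apply: IM.
Qed.

Let mem_prime : prime_idealr_closed mem.
Proof.
by move=> x y /asboolP/primeI[]Ix; apply/orP; [left|right]; apply/asboolP.
Qed.

HB.instance Definition _ := isIdealr.Build R mem mem_idealr.
HB.instance Definition _ := isPrimeIdealrClosed.Build R mem mem_prime.

Lemma prime_of_set : exists p : Spec R, forall x, (x \in p) <-> I x.
Proof. by exists (mem : prime_idealr R) => x; split=> /asboolP. Qed.

End PrimeOfSet.

Lemma exists_zero_prime (D : idomainType) :
  exists p : Spec D, forall x, (x \in p) = (x == 0).
Proof.
have [||x y|p pP] := @prime_of_set D [set 0].
- by split=> [//|_ _ -> ->|a _ ->] /=; rewrite ?addr0 ?mulr0.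
- by move=> /= /eqP; rewrite oner_eq0.
- by move=> /= /eqP; rewrite mulf_eq0 => /orP[]/eqP ->; [left|right].
by exists p => x; apply/idP/eqP => /pP.
Qed.

Lemma mem_spec_ideal (R : comNzRingType) (p : Spec R) :
  is_ideal [set x | x \in p].
Proof.
split=> [|x y /= px py|a x /= px]; first exact: idealr0.
- exact: rpredD.
- exact: idealMr.
Qed.

(** Noetherian induction on closed subsets: a reducible one is a union of two
smaller ones, and an irreducible one is the union of a smaller one and of a
non-empty open part.  Hence only some open neighborhood of the generic point of
every irreducible closed subset has to be dealt with. *)
Lemma spec_ind (R : comNzRingType) (Q : set (Spec R) -> Prop) : noetherian R ->
  (forall A B, A `<=` B -> Q B -> Q A) -> Q set0 ->
  (forall A B, Q A -> Q B -> Q (A `|` B)) ->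
  (forall p : Spec R, exists2 h, h \notin p &
     Q [set s : Spec R | {subset p <= s} /\ h \notin s]) ->
  Q setT.
Proof.
move=> noethR Qsub Q0 QU Qgen.
pose V (I : set R) := [set s : Spec R | forall x, I x -> x \in s].
suff QV I : is_ideal I -> Q (V I).
  apply: Qsub (QV [set 0] _).
    by move=> s _ _ ->; apply: idealr0.
  by split=> [//|_ _ -> ->|a _ ->] /=; rewrite ?addr0 ?mulr0.
move: I; apply: noetherian_ideal_ind noethR _ => I idI IH.
have QVadjoin x : ~ I x -> Q (V (adjoin I x)).
  move=> nIx; apply: IH (@adjoin_ideal _ I x idI) (@sub_adjoin _ I x) _.
  by move=> /(_ x (@adjoin_mem _ I x idI)).
have V_adjoin x s : V I s -> x \in s -> V (adjoin I x) s.
  by move=> sI sx _ [i Ii [b ->]]; rewrite rpredD ?idealMr// sI.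
have [I1|properI] := pselect (I 1).
  by apply: Qsub Q0 => s /(_ 1 I1); rewrite idealr1.
have [[x [y [Ixy nIx nIy]]]|nprod] :=
    pselect (exists x y, [/\ I (x * y), ~ I x & ~ I y]).
  apply: Qsub (QU _ _ (QVadjoin x nIx) (QVadjoin y nIy)) => s sI.
  have := sI _ Ixy; rewrite prime_idealrM => /orP[sx|sy]; [left|right];
    exact: V_adjoin.
have [|p pI] := prime_of_set idI properI.
  move=> x y Ixy; apply: contrapT => /not_orP[nIx nIy].
  by apply: nprod; exists x, y.
have [h ph Qh] := Qgen p.
have nIh : ~ I h by move=> /pI; apply/negP.
apply: Qsub (QU _ _ Qh (QVadjoin h nIh)) => s sI.
case: (boolP (h \in s)) => hs; [right; exact: V_adjoin|left; split=> //].
by move=> x /pI; apply: sI.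
Qed.

(** * Hilbert's basis theorem *)

Lemma noetherian_surj (A B : comNzRingType) (f : {rmorphism A -> B}) :
  (forall y, exists x, f x = y) -> noetherian A -> noetherian B.
Proof.
move=> fsurj noethA I [I0 ID IM].
have [|n [g Ig]] := noethA (f @^-1` I).
  split=> [|x y|a x] /=; rewrite ?rmorph0 ?rmorphD ?rmorphM //; first exact: ID.
  exact: IM.
exists n, (f \o g); apply/seteqP; split=> y.
  have [x <-] := fsurj y => Ifx.
  have : (f @^-1` I) x by [].
  rewrite Ig => -[c ->]; exists (f \o c); rewrite rmorph_sum.
  by apply: eq_bigr => i _; rewrite rmorphM.
move=> [c ->]; apply: (big_ind (fun y => I y)) => // i _; apply: IM.
suff : (f @^-1` I) (g i) by [].
rewrite Ig; exists (fun j => (j == i)%:R).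
rewrite (bigD1 i) //= eqxx mul1r big1 ?addr0 // => j.
by move=> /negPf ->; rewrite mul0r.
Qed.

(** An ideal which is not finitely generated contains a sequence of polynomials,
each of least degree outside the ideal generated by the previous ones.  By the
ascending chain condition, some leading coefficient is a combination of the
previous ones, which allows the degree of that polynomial to be lowered. *)
Lemma noetherian_poly (R : comNzRingType) :
  noetherian R -> noetherian {poly R}.
Proof.
move=> noethR I idI; apply: contrapT => nfg.
pose spn (s : seq {poly R}) := ideal_span (nth 0 s) (size s).
pose fresh s g := I g /\ ~ spn s g.
have /choice[next nextP] (s : seq {poly R}) : exists g,
    (forall i, (i < size s)%N -> I (s`_i)) ->
    fresh s g /\ forall h, fresh s h -> (size g <= size h)%N.
  have [sI|nsI] := pselect (forall i, (i < size s)%N -> I (s`_i)); last first.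
    by exists 0.
  have [g0 g0P] : exists g, fresh s g.
    apply: contrapT => nex; apply: nfg; exists (size s), (fun i => s`_i).
    apply/seteqP; split=> [g Ig|_ [c ->]].
      have [c ->] : spn s g by apply: contrapT => nsg; apply: nex; exists g.
      by exists (fun i => c i).
    case: idI => I0 ID IM.
    by apply: (big_ind (fun x => I x)) => // i _; apply/IM/sI.
  have ex : exists k, `[< exists2 g, fresh s g & size g = k >].
    by exists (size g0); apply/asboolP; exists g0.
  have /asboolP[g gP gk] := xchooseP ex; have := ex_minnP ex.
  case=> k /asboolP[h hP hk] kmin; exists h => _; split=> // h' h'P.
  by rewrite hk; apply: kmin; apply/asboolP; exists h'.
pose hist n := iter n (fun s => rcons s (next s)) [::].
pose f n := next (hist n).
have size_hist n : size (hist n) = n.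
  by elim: n => //= n IH; rewrite size_rcons IH.
have nth_hist n i : (i < n)%N -> (hist n)`_i = f i.
  elim: n => // n IH; rewrite ltnS leq_eqVlt /= nth_rcons size_hist.
  by case: ltngtP => // [/IH//|-> _].
have spn_hist n : spn (hist n) = ideal_span f n.
  by rewrite /spn size_hist; apply: eq_ideal_span => i /nth_hist.
have If n i : (i < n)%N -> I (f i).
  elim: n i => // n IH i; rewrite ltnS leq_eqVlt => /predU1P[->|/IH//].
  have [|[]//] := nextP (hist n).
  by rewrite size_hist => j jn; rewrite nth_hist //; apply: IH.
have fP n : fresh (hist n) (f n) /\
    forall h, fresh (hist n) h -> (size (f n) <= size h)%N.
  apply: nextP => i; rewrite size_hist => ilt.
  by rewrite nth_hist //; apply: If ilt.
have [k [c fk]] := noetherian_stationary (fun n => lead_coef (f n)) noethR.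
have [[Ifk nfk] fmin] := fP k; rewrite spn_hist in nfk.
have size_le i : (i < k)%N -> (size (f i) <= size (f k))%N.
  move=> ik; have [_] := fP i; apply; split=> //.
  by rewrite spn_hist => /(ideal_span_le (ltnW ik)).
pose u i : {poly R} := c i *: 'X^(size (f k) - size (f i)).
(* The leading terms cancel: g has smaller degree than f k. *)
pose g := f k - \sum_(i < k) u i * f i.
have sumf : ideal_span f k (\sum_(i < k) u i * f i) by exists u.
have nzf i : (i <= k)%N -> f i != 0.
  move=> ik; have [[_ nfi] _] := fP i; apply/eqP => fi0; apply: nfi.
  by rewrite fi0 spn_hist; case: (ideal_span_is_ideal f i).
have sz_f : (0 < size (f k))%N by rewrite size_poly_gt0 nzf.
have gfresh : fresh (hist k) g.
  case: (idI) => I0 ID IM; split.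
    apply: ID => //; rewrite -mulN1r; apply: IM.
    by apply: (ideal_span_sub idI (If k) sumf).
  rewrite spn_hist => gk; apply: nfk.
  rewrite -(subrK (\sum_(i < k) u i * f i) (f k)).
  by case: (ideal_span_is_ideal f k) => _ + _; apply.
have := fmin g gfresh; rewrite leqNgt => /negP; apply.
rewrite -(prednK sz_f) ltnS.
apply/leq_sizeP => j; rewrite leq_eqVlt => /predU1P[<-|jlt].
  rewrite coefB -lead_coefE fk coef_sum; apply/eqP; rewrite subr_eq0; apply/eqP.
  apply: eq_bigr => i _; rewrite -scalerAl coefZ coefXnM.
  have zi : (0 < size (f i))%N by rewrite size_poly_gt0 nzf // ltnW.
  have szi := size_le i (ltn_ord i).
  rewrite ltnNge; have -> : (size (f k) - size (f i) <= (size (f k)).-1)%N.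
    by rewrite -subn1 leq_sub2l.
  rewrite /= lead_coefE; congr (_ * _`_ _).
  by move: zi szi sz_f; move: (size (f i)) (size (f k)) => a b; lia.
have sz_lt : (size (f k) <= j)%N by rewrite -(prednK sz_f).
rewrite coefB nth_default // sub0r coef_sum big1 ?oppr0 // => i _.
rewrite -scalerAl coefZ coefXnM; case: ifP => [_|_]; first by rewrite mulr0.
rewrite nth_default ?mulr0 // leq_subRL; last first.
  exact: leq_trans (leq_subr _ _) sz_lt.
by rewrite addnC subnKC // size_le.
Qed.

Section MpolyMorphisms.
Variables (n : nat) (R : comNzRingType).

Lemma mpoly_gen_ind (P : mpoly n R -> Prop) :
  (forall c, P (mpolyC n c)) -> (forall i, P (mvar i)) ->
  (forall p q, P p -> P q -> P (p + q)) ->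
  (forall p q, P p -> P q -> P (p * q)) -> forall p, P p.
Proof.
move=> PC PX PD PM p; rewrite [p]mpoly.mpolyE.
have P1 : P 1 by have := PC 1; rewrite rmorph1.
have P0 : P 0 by have := PC 0; rewrite rmorph0.
apply: (big_ind P) => [//|x y Px Py|m _]; first exact: PD.
rewrite -mpoly.mul_mpolyC; apply: (PM _ _) => //.
rewrite mpoly.mpolyXE_id; apply: (big_ind P) => [//|x y Px Py|i _].
  exact: PM.
by elim: (mpoly.fun_of_multinom m i) => [|k IH]; rewrite ?exprS//; apply: PM.
Qed.

Lemma eq_mpoly_morph (S : comNzRingType) (f g : {rmorphism mpoly n R -> S}) :
  (forall c, f (mpolyC n c) = g (mpolyC n c)) ->
  (forall i, f (mvar i) = g (mvar i)) -> f =1 g.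
Proof.
move=> fgC fgX; apply: mpoly_gen_ind => // p q fgp fgq.
  by rewrite !rmorphD fgp fgq.
by rewrite !rmorphM fgp fgq.
Qed.

Lemma mmap_mvar (S : comNzRingType) (f : {rmorphism R -> S}) (h : 'I_n -> S)
    i :
  mpoly.mmap f h (mvar i) = h i.
Proof. by rewrite mpoly.mmapX mpoly.mmap1U. Qed.

End MpolyMorphisms.

Lemma noetherian_mpoly (R : comNzRingType) n :
  noetherian R -> noetherian (mpoly n R).
Proof.
(* R[x_0, ..., x_n] is the image of R[x_1, ..., x_n][X], with X sent to x_0. *)
move=> noethR; elim: n => [|n IH].
  apply: (noetherian_surj (f := @mpolyC 0 R)) noethR => p.
  elim/mpoly_gen_ind: p => [c|[]//|_ _ [a <-] [b <-]|_ _ [a <-] [b <-]].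
  - by exists c.
  - by exists (a + b); rewrite rmorphD.
  - by exists (a * b); rewrite rmorphM.
pose lower : {rmorphism mpoly n R -> mpoly n.+1 R} :=
  mpoly.mmap (@mpolyC n.+1 R) (fun i => mvar (lift ord0 i)).
have comm : commr_rmorph lower (mvar ord0) by move=> p; apply: mulrC.
apply: (noetherian_surj (f := horner_morph comm)) (noetherian_poly IH) => p.
elim/mpoly_gen_ind: p => [c|i|_ _ [a <-] [b <-]|_ _ [a <-] [b <-]].
- by exists (mpolyC n c)%:P; rewrite /= horner_morphC /lower /= mpoly.mmapC.
- have [j ->|->] := unliftP ord0 i; last by exists 'X; rewrite /= horner_morphX.
  by exists (mvar j)%:P; rewrite /= horner_morphC /lower /= mmap_mvar.
- by exists (a + b); rewrite rmorphD.
- by exists (a * b); rewrite rmorphM.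
Qed.

(** * Patch-closed sets of primes *)

Lemma mem_spec_map (A B : comNzRingType) (f : {rmorphism A -> B}) (q : Spec B)
    x :
  (x \in spec_map f q) = (f x \in q).
Proof. by []. Qed.

Lemma spec_eq (R : comNzRingType) (p q : Spec R) : p =i q -> p = q.
Proof.
move=> pq; have : (p : R -> bool) = q by apply/funext => x; exact: pq x.
case: p q {pq} => p [[a1] [b1] [c1] [d1]] [q [[a2] [b2] [c2] [d2]]] /= pq.
subst q; congr (PrimeIdealr.Pack (PrimeIdealr.Class _ _ _ _)); congr (_ _);
  exact: Prop_irrelevance.
Qed.

Section Primes.
Variable R : comNzRingType.
Implicit Types (p q s : Spec R) (T : set (Spec R)).

Lemma prod_notin p (I : Type) (r : seq I) (P : pred I) (F : I -> R) :
  (forall i, P i -> F i \notin p) -> \prod_(i <- r | P i) F i \notin p.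
Proof.
move=> pF; apply: (big_ind (fun x => x \notin p)) => [|x y px py|//].
  by rewrite idealr1.
by rewrite prime_idealrM negb_or px.
Qed.

Lemma prod_in p (I : eqType) (r : seq I) (F : I -> R) i :
  i \in r -> F i \in p -> \prod_(j <- r) F j \in p.
Proof. by move=> ri pF; rewrite (big_rem i) //= mulrC idealMr. Qed.

(** In terms of the topology: T is disjoint from a neighborhood of p in the
closure of p, for every p outside T.  In a noetherian spectrum this
characterizes the closed subsets for the constructible topology, that is, the
pro-constructible ones. *)
Definition patch_closed T := forall p, ~ T p ->
  exists2 e, e \notin p & forall q, T q -> {subset p <= q} -> e \in q.

Lemma closed_zero_locus (C : set (Spec R)) :
  closed C -> exists E, C = zero_locus E.
Proof.
rewrite -openC => -[E CE]; exists E.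
by rewrite -[C]setCK CE setCK.
Qed.

Lemma patch_closed_bigcup m (T : 'I_m -> set (Spec R)) :
  (forall i, patch_closed (T i)) -> patch_closed (\bigcup_i T i).
Proof.
move=> clT p npT.
have /choice[e eP] (i : 'I_m) : exists e, e \notin p /\
    forall q, T i q -> {subset p <= q} -> e \in q.
  have [|e pe eT] := clT i p; first by move=> Tp; apply: npT; exists i.
  by exists e.
exists (\prod_i e i); first by apply: prod_notin => i _; case: (eP i).
move=> q [i _ Tq] pq; apply: prod_in (mem_index_enum i) _.
by have [_] := eP i; apply.
Qed.

Lemma constructible_patch_closed T : constructible T -> patch_closed T.
Proof.
case=> n [U [C [UC ->]]]; apply: patch_closed_bigcup => i p npUC.
have [[E UE] /closed_zero_locus[F CF]] := UC i.
have [pC|] := pselect (C i p).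
  have /contrapT pE : ~ ~ zero_locus E p.
    by move=> pE; apply: npUC; split=> //; rewrite UE.
  exists 1; rewrite ?idealr1// => q [+ _] pq; rewrite UE.
  by case=> x Ex; apply/pq/pE.
rewrite CF => /existsNP[x /not_implyP[Fx /negP px]]; exists x => //.
by move=> q [_ /(_ x Fx)].
Qed.

Lemma pro_constructible_patch_closed T : pro_constructible T -> patch_closed T.
Proof.
case=> F [Fcons ->] p /existsNP[B /not_implyP[FB npB]].
have [e pe eB] := constructible_patch_closed (Fcons B FB) npB.
by exists e => // q /(_ B FB); apply: eB.
Qed.

Hypothesis noethR : noetherian R.

(** T has finitely many minimal points, and every point of T is a specialization
of one of them.  By noetherian induction, it suffices to look near the generic
point p of an irreducible closed set: either p is in T and is the only minimal
point there, or T is empty near p. *)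
Lemma patch_closed_basis T : patch_closed T ->
  exists X : seq (Spec R), (forall p, p \in X -> T p) /\
    forall q, T q -> exists2 p, p \in X & {subset p <= q}.
Proof.
move=> clT.
suff [X [XT XP]] : exists X : seq (Spec R), (forall p, p \in X -> T p) /\
    forall q, setT q -> T q -> exists2 p, p \in X & {subset p <= q}.
  by exists X; split=> // q; apply: XP.
apply: (@spec_ind _ (fun S => exists X : seq (Spec R),
    (forall p, p \in X -> T p) /\
    forall q, S q -> T q -> exists2 p, p \in X & {subset p <= q}) noethR)
    => [A B AB [X [XT XP]]||A B [X [XT XP]] [Y [YT YP]]|p].
- by exists X; split=> // q /AB; apply: XP.
- by exists [::].
- exists (X ++ Y); split=> [p|q [/XP XPq|/YP YPq] Tq].
  + by rewrite mem_cat => /orP[/XT|/YT].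
  + by have [p Xp] := XPq Tq; exists p; rewrite // mem_cat Xp.
  + by have [p Yp] := YPq Tq; exists p; rewrite // mem_cat Yp orbT.
- have [Tp|/clT[e pe eT]] := pselect (T p).
    exists 1; first by rewrite idealr1.
    exists [:: p]; split=> [q|q [pq _] _]; first by rewrite inE => /eqP ->.
    by exists p; rewrite ?inE.
  by exists e => //; exists [::]; split=> // q [pq /negP eq] /eT/(_ pq).
Qed.

(** * Residue rings and approximation *)

Definition maximal_prime p := forall x, x \notin p -> exists y, 1 - x * y \in p.

Lemma maximal_prime_eq p q : maximal_prime p -> {subset p <= q} -> p = q.
Proof.
move=> pmax pq; apply: spec_eq => x; apply/idP/idP => [/pq//|qx].
apply/negPn/negP => /pmax[y /pq].
move=> q1; have := rpredD q1 (idealMr y qx).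
by rewrite mulrC subrK idealr1.
Qed.

Definition distinct_residues p (c : nat) (r : nat -> R) :=
  forall i j, (i < j < c)%N -> r j - r i \notin p.

(** R / p has at least c elements. *)
Definition many_residues p (c : nat) := exists r, distinct_residues p c r.

(** A finite integral domain is a field: two powers of an element x which is
non-zero modulo p coincide, and cancelling the lower one inverts x. *)
Lemma few_residues_maximal p c : ~ many_residues p c -> maximal_prime p.
Proof.
move=> few x px; apply: contrapT => nex; apply: few.
exists (fun i => x ^+ i) => i j /andP[ij _]; apply/negP => pij; apply: nex.
exists (x ^+ (j - i).-1); rewrite -exprS prednK ?subn_gt0 // -opprB rpredN.
have : x ^+ i * (x ^+ (j - i) - 1) \in p.
  by rewrite mulrBr mulr1 -exprD subnKC // ltnW.
rewrite prime_idealrM => /orP[|//]; rewrite -[i]card_ord -prodr_const.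
by apply: contraTT => _; apply: prod_notin.
Qed.

(** If r_0, ..., r_(c-1) are distinct modulo p, they remain so modulo every s
above p which does not contain the product of their differences; and if R / p
has fewer than c elements, p is maximal and has no other prime above it. *)
Lemma few_residues_finite c :
  exists X : seq (Spec R), forall s, ~ many_residues s c -> s \in X.
Proof.
suff [X XP] : exists X : seq (Spec R), forall s, setT s ->
    ~ many_residues s c -> s \in X by exists X => s; apply: XP.
apply: (@spec_ind _ (fun S => exists X : seq (Spec R), forall s, S s ->
    ~ many_residues s c -> s \in X) noethR)
    => [A B AB [X XP]||A B [X XP] [Y YP]|p].
- by exists X => q /AB; apply: XP.
- by exists [::].
- exists (X ++ Y) => s [/XP Xs|/YP Ys] ns; rewrite mem_cat.
    by rewrite Xs.
  by rewrite Ys ?orbT.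
- have [[r rP]|few] := pselect (many_residues p c).
    exists (\prod_(j < c) \prod_(i < j) (r j - r i)).
      apply: prod_notin => j _; apply: prod_notin => i _.
      by rewrite rP // !ltn_ord.
    exists [::] => s [_ /negP sh] [] ; exists r => i j /andP[ij jc].
    apply/negP => sij; apply: sh.
    apply: (@prod_in s _ _ _ (Ordinal jc)); first exact: mem_index_enum.
    by apply: (@prod_in s _ _ _ (Ordinal ij)); first exact: mem_index_enum.
  exists 1; first by rewrite idealr1.
  exists [:: p] => s [/(maximal_prime_eq (few_residues_maximal few)) -> _] _.
  by rewrite inE.
Qed.

Lemma mem_to_residue_domain p x : (to_residue_domain p x == 0) = (x \in p).
Proof.
by rewrite -(rmorph0 (to_residue_domain p)) /= -Quotient.idealrBE subr0.
Qed.

Lemma exists_nonroot p c (F : {poly R}) i r :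
  (size F <= c)%N -> F`_i \notin p ->
  distinct_residues p c r -> exists k, F.[r k] \notin p.
Proof.
move=> Fc pFi rP; pose f := to_residue_domain p.
have fE x : (f x == 0) = (x \in p) by apply: mem_to_residue_domain.
apply: contrapT => nex.
have nzF : map_poly f F != 0.
  apply/negP => /eqP/(congr1 (fun P : {poly _} => P`_i)).
  by rewrite coef_map coef0 => /eqP; rewrite fE; apply/negP.
have := @max_poly_roots _ (map_poly f F) [seq f (r k) | k <- iota 0 c] nzF.
rewrite size_map size_iota ltnNge (leq_trans (size_poly _ _)) //.
have -> : all (root (map_poly f F)) [seq f (r k) | k <- iota 0 c].
  apply/allP => _ /mapP[k _ ->]; rewrite /root horner_map fE.
  by apply/negPn/negP => pFk; apply: nex; exists k.
suff -> : uniq [seq f (r k) | k <- iota 0 c] by move=> /(_ isT isT).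
rewrite map_inj_in_uniq ?iota_uniq // => j k.
rewrite !mem_iota !add0n /= => jc kc /eqP; rewrite -subr_eq0 -rmorphB fE => pjk.
case: (ltngtP j k) => // [jk|kj]; exfalso.
  have := rP j k; rewrite jk kc => /(_ isT)/negP; apply.
  by rewrite -opprB rpredN.
by have := rP k j; rewrite kj jc => /(_ isT)/negP; apply.
Qed.

End Primes.

Section Approximation.
Variable R : comNzRingType.
Implicit Types (p q s : Spec R) (X : seq (Spec R)) (D : seq (Spec R * R)).

Lemma exists_in_primes_notin X p :
  (forall q, q \in X -> ~ {subset q <= p}) ->
  exists2 y, y \notin p & forall q, q \in X -> y \in q.
Proof.
elim: X => [_|q X IH Xp]; first by exists 1; rewrite ?idealr1.
have [|y py Xy] := IH; first by move=> s sX; apply: Xp; rewrite inE sX orbT.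
have /existsNP[x /not_implyP[qx /negP px]] := Xp q (mem_head _ _).
exists (x * y); first by rewrite prime_idealrM negb_or px.
move=> s; rewrite inE prime_idealrM => /predU1P[->|/Xy ->]; last exact: orbT.
by rewrite qx.
Qed.

Lemma chinese_maximal X (b : Spec R -> R) :
  (forall p, p \in X -> maximal_prime p) ->
  exists a, forall p, p \in X -> a - b p \in p.
Proof.
elim: X => [_|p X IH Xmax]; first by exists 0.
have [|a aX] := IH; first by move=> q qX; apply: Xmax; rewrite inE qX orbT.
have [pX|npX] := boolP (p \in X).
  by exists a => q; rewrite inE => /predU1P[->|]; apply: aX.
have [q qX qp|y py Xy] := @exists_in_primes_notin X p.
  have qmax : maximal_prime q by apply: Xmax; rewrite inE qX orbT.
  by move: npX; rewrite -(maximal_prime_eq qmax qp) qX.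
have [z yz] := Xmax p (mem_head _ _) y py.
exists (a + (b p - a) * (y * z)) => q; rewrite inE => /predU1P[->|qX].
  have -> : a + (b p - a) * (y * z) - b p = (a - b p) * (1 - y * z).
    by rewrite mulrBr mulr1 addrAC -(opprB a (b p)) mulNr.
  exact: idealMr.
rewrite addrAC; apply: rpredD; first exact: aX.
by rewrite [y * z]mulrC mulrA idealMr // Xy.
Qed.

Lemma exists_minimal_prime D : D != [::] -> exists2 d, d \in D &
  forall e, e \in D -> {subset e.1 <= d.1} -> {subset d.1 <= e.1}.
Proof.
elim: D => // d D IH _; have [->|nzD] := eqVneq D [::].
  by exists d; rewrite ?mem_head // => e; rewrite inE => /eqP ->.
have [m mD mmin] := IH nzD.
have [dm|ndm] := pselect {subset d.1 <= m.1}.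
  exists d; rewrite ?mem_head // => e.
  rewrite inE => /predU1P[-> //|eD ed] x dx.
  by apply: mmin eD _ _ (dm x dx) => y /ed/dm.
exists m; first by rewrite inE mD orbT.
by move=> e; rewrite inE => /predU1P[-> //|]; apply: mmin.
Qed.

(** A pigeonhole argument: the values of t for which a + t * y meets the residue
of a given b form at most one residue class modulo p. *)
Lemma exists_avoid_residues p (B : seq R) a y :
  (forall c, many_residues p c) ->
  y \notin p -> exists t, forall b, b \in B -> a + t * y - b \notin p.
Proof.
move=> many py; have [r rP] := many (size B).+1; apply: contrapT => nex.
have /choice[g gP] (i : nat) : exists b, b \in B /\ a + r i * y - b \in p.
  apply: contrapT => ni; apply: nex; exists (r i) => b bB; apply/negP => pb.
  by apply: ni; exists b.
suff : uniq [seq g i | i <- iota 0 (size B).+1].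
  have gB : {subset [seq g i | i <- iota 0 (size B).+1] <= B}.
    by move=> _ /mapP[i _ ->]; case: (gP i).
  by move=> /uniq_leq_size/(_ gB); rewrite size_map size_iota ltnn.
have ginj i j : (i < j < (size B).+1)%N -> g i != g j.
  move=> ij; apply/eqP => gij; have [_ pi] := gP i; have [_ pj] := gP j.
  have : (r j - r i) * y \in p.
    rewrite mulrBl.
    have -> : r j * y - r i * y = (a + r j * y - g j) - (a + r i * y - g i).
      by rewrite gij opprB addrA subrK opprD addrACA subrr add0r.
    by rewrite rpredB.
  by rewrite prime_idealrM (negPf (rP i j ij)) (negPf py).
rewrite map_inj_in_uniq ?iota_uniq // => i j.
rewrite !mem_iota !add0n => /= iB jB gij.
case: (ltngtP i j) => // [ij|ji]; exfalso.
  by have := ginj i j; rewrite ij jB gij eqxx => /(_ isT).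
by have := ginj j i; rewrite ji iB gij eqxx => /(_ isT).
Qed.

(** The pairs (p, b) of D stand for the cosets b + p.  They are avoided by
induction on their number: if p is a minimal prime occurring in D, then a is
first found for the cosets of the other primes, and next modified by a multiple
of some y which lies in all these primes but not in p.  This does not affect the
other cosets, and the finitely many cosets of p are avoided because R / p is
infinite. *)
Lemma exists_avoid_cosets X D a0 :
  (forall p, p \in X -> maximal_prime p) ->
  (forall d, d \in D -> d.1 \notin X) ->
  (forall d, d \in D -> forall c, many_residues d.1 c) ->
  exists a, (forall p, p \in X -> a - a0 \in p) /\
            (forall d, d \in D -> a - d.2 \notin d.1).
Proof.
move=> Xmax; have [n] := ubnP (size D); elim: n D => // n IH D sD DX Dmany.
have [->|/exists_minimal_prime[m mD mmin]] := eqVneq D [::].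
  by exists a0; split=> // p _; rewrite subrr idealr0.
pose D' := [seq d <- D | d.1 != m.1].
have D'D d : d \in D' -> d \in D by rewrite mem_filter => /andP[].
have [|||a [aX aD']] := IH D'.
- rewrite -ltnS (leq_trans _ sD) // ltnS size_filter.
  rewrite -(count_predC (fun d => d.1 != m.1) D).
  rewrite -[X in (X < _)%N]addn0 ltn_add2l -has_count.
  by apply/hasP; exists m; rewrite //= negbK.
- by move=> d /D'D; apply: DX.
- by move=> d /D'D; apply: Dmany.
have [q|y my yX] := @exists_in_primes_notin (X ++ [seq d.1 | d <- D']) m.1.
  rewrite mem_cat => /orP[qX qm|/mapP[d]].
    by have := DX m mD; rewrite -(maximal_prime_eq (Xmax q qX) qm) qX.
  rewrite mem_filter => /andP[/negP ndm dD] -> dm; apply: ndm.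
  by apply/eqP/spec_eq => x; apply/idP/idP => [/dm//|]; apply: mmin.
have [t tP] :=
  @exists_avoid_residues m.1 [seq d.2 | d <- D] a y (Dmany m mD) my.
exists (a + t * y); split=> [p pX|d dD].
  by rewrite addrAC rpredD ?aX // idealMr // yX // mem_cat pX.
have [dm|ndm] := eqVneq d.1 m.1; first by rewrite dm; apply/tP/map_f.
have dD' : d \in D' by rewrite mem_filter ndm.
apply: contra (aD' d dD') => Hd.
have -> : a - d.2 = a + t * y - d.2 - t * y by rewrite addrAC addrK.
by rewrite rpredB // idealMr // yX // mem_cat (map_f (fun d => d.1) dD') orbT.
Qed.

End Approximation.

(** * Affine space *)

Section GenericPoint.
Variables (n : nat) (R : comNzRingType).
Implicit Types (s : Spec R) (f : mpoly n R) (q : Spec (mpoly n R)).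

Lemma generic_point_subproof s : exists q : Spec (mpoly n R),
  forall f, (f \in q) <-> forall m, mpoly.mcoeff m f \in s.
Proof.
have [q qP] := exists_zero_prime (mpoly n (residue_domain s)).
exists (spec_map (mpoly.map_mpoly (to_residue_domain s)) q) => f.
rewrite mem_spec_map qP; split=> [/eqP fs m|fs].
  rewrite -mem_to_residue_domain -mpoly.mcoeff_map_mpoly fs.
  exact/eqP/mpoly.mcoeff0.
apply/eqP/mpoly.mpolyP => m; rewrite mpoly.mcoeff_map_mpoly mpoly.mcoeff0.
by apply/eqP; rewrite mem_to_residue_domain.
Qed.

(** The generic point of the fiber of the affine space over s. *)
Definition generic_point s := sval (cid (generic_point_subproof s)).

Lemma mem_generic_point s f :
  (f \in generic_point s) <-> forall m, mpoly.mcoeff m f \in s.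
Proof. by rewrite /generic_point; case: cid => q /= qP; apply: qP. Qed.

Lemma generic_pointPn s f :
  f \notin generic_point s -> exists m, mpoly.mcoeff m f \notin s.
Proof.
move=> /negP nf; apply: contrapT => nex; apply/nf/mem_generic_point => m.
by apply/negPn/negP => fm; apply: nex; exists m.
Qed.

Lemma mem_structure_map q x : (x \in structure_map q) = (mpolyC n x \in q).
Proof. by []. Qed.

Lemma generic_point_sub s q :
  {subset s <= structure_map q} -> {subset generic_point s <= q}.
Proof.
move=> sq f /mem_generic_point fs; rewrite [f]mpoly.mpolyE.
apply: rpred_sum => m _; rewrite -mpoly.mul_mpolyC mulrC idealMr //.
by have := sq _ (fs m).
Qed.

Lemma structure_map_generic_point s : structure_map (generic_point s) = s.
Proof.
apply: spec_eq => x; rewrite mem_structure_map; apply/idP/idP.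
  by move=> /mem_generic_point/(_ mpoly.mnm0); rewrite mpoly.mpolyCK.
move=> xs; apply/mem_generic_point => m.
by rewrite mpoly.mcoeffC mulrC idealMr.
Qed.

(** The image of s under the section defined by c. *)
Definition rat_point (c : 'I_n -> R) s : Spec (mpoly n R) :=
  spec_map (mpoly.meval c) s.

Lemma mem_rat_point c s f : (f \in rat_point c s) = (mpoly.meval c f \in s).
Proof. by []. Qed.

Lemma structure_map_rat_point c s : structure_map (rat_point c s) = s.
Proof.
by apply: spec_eq => x; rewrite mem_structure_map mem_rat_point mpoly.mevalC.
Qed.

End GenericPoint.

Lemma rat_point_congr n (R : comNzRingType) (s : Spec R) (c c' : 'I_n -> R) :
  (forall i, c i - c' i \in s) -> rat_point c s = rat_point c' s.
Proof.
move=> cc'; apply: spec_eq => f; rewrite !mem_rat_point -!mem_to_residue_domain.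
congr (_ == 0); pose f1 := to_residue_domain s.
apply: (eq_mpoly_morph (f := f1 \o mpoly.meval c)
  (g := f1 \o mpoly.meval c')) => [a|i] /=.
  by rewrite !mpoly.mevalC.
rewrite !mpoly.mevalXU; apply/eqP.
by rewrite -subr_eq0 -rmorphB mem_to_residue_domain.
Qed.

(** * A curve in general position *)

Definition exponents_lt n (R : comNzRingType) d (f : mpoly n R) :=
  forall m, m \in mpoly.msupp f -> forall i, (mpoly.fun_of_multinom m i < d)%N.

Lemma exists_exponents_lt n (R : comNzRingType) (f : mpoly n R) :
  exists d, exponents_lt d f.
Proof.
exists (\max_(m <- mpoly.msupp f) mpoly.mdeg m).+1 => m mf i.
rewrite ltnS (big_rem m) //= leq_max mpoly.mdegE.
by rewrite (bigD1 i) //= leq_addr.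
Qed.

Section Kronecker.

Lemma digits_lt d n (x : 'I_n -> nat) : (forall i, (x i < d)%N) ->
  (\sum_(i < n) x i * d ^ i < d ^ n)%N.
Proof.
elim: n x => [|n IH] x xd; first by rewrite big_ord0 expn0.
rewrite big_ord_recr /= expnS.
have := IH _ (fun i => xd (widen_ord (leqnSn n) i)); have := xd ord_max.
by move: (\sum_(i < n) _)%N => S; nia.
Qed.

Lemma digits_inj d n (x y : 'I_n -> nat) :
  (forall i, (x i < d)%N) -> (forall i, (y i < d)%N) ->
  (\sum_(i < n) x i * d ^ i = \sum_(i < n) y i * d ^ i)%N -> x =1 y.
Proof.
elim: n x y => [|n IH] x y xd yd; first by move=> _ [].
rewrite !big_ord_recr /= => e.
have xl := digits_lt (fun i => xd (widen_ord (leqnSn n) i)).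
have yl := digits_lt (fun i => yd (widen_ord (leqnSn n) i)).
have Dgt0 : (0 < d ^ n)%N by apply: leq_ltn_trans xl.
have xy : x ord_max = y ord_max.
  have := congr1 (fun k => k %/ d ^ n)%N e.
  by rewrite /= ![(_ + _ * d ^ n)%N]addnC !divnMDl // !divn_small // !addn0.
move: e; rewrite xy => /addIn e i.
have := ltn_ord i; rewrite ltnS leq_eqVlt => /predU1P[ni|ilt].
  by have -> : i = ord_max by apply: val_inj.
have -> : i = widen_ord (leqnSn n) (Ordinal ilt) by apply: val_inj.
exact: IH (fun i => xd (widen_ord _ i)) (fun i => yd (widen_ord _ i)) e _.
Qed.

Definition monic_size (R : comNzRingType) k (F : {poly R}) :=
  F \is monic /\ size F = k.+1.

Section MonicSize.
Variable R : comNzRingType.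
Implicit Type F : {poly R}.

Lemma monic_size1 : monic_size 0 (1 : {poly R}).
Proof. by split; [apply: monic1|rewrite size_poly1]. Qed.

Lemma monic_sizeM k l F G : monic_size k F -> monic_size l G ->
  monic_size (k + l) (F * G).
Proof.
move=> [Fm Fk] [Gm Gl]; split; first exact: rpredM.
by rewrite size_Mmonic ?monic_neq0 // Fk Gl addnS.
Qed.

Lemma monic_size_exp k j F : monic_size k F -> monic_size (j * k) (F ^+ j).
Proof.
move=> Fk; elim: j => [|j IH]; first exact: monic_size1.
by rewrite exprS mulSn; apply: monic_sizeM.
Qed.

Lemma monic_size_prod n (k : 'I_n -> nat) (F : 'I_n -> {poly R}) :
  (forall i, monic_size (k i) (F i)) ->
  monic_size (\sum_i k i)%N (\prod_i F i).
Proof.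
move=> Fk; apply: (big_ind2 (fun l G => monic_size l G)) => //.
  exact: monic_size1.
by move=> l G l' G'; apply: monic_sizeM.
Qed.

Lemma monic_size_XnaddC k (a : R) : (0 < k)%N -> monic_size k ('X^k + a%:P).
Proof.
by move=> k0; split; [apply: monicXnaddC|apply: size_XnaddC].
Qed.

End MonicSize.

Variables (R : comNzRingType) (n : nat).

(** Along the curve t -> (t ^ (d ^ i) + c i)_i, the monomial x^m becomes a monic
polynomial of degree sum_i m_i * d ^ i.  If all exponents are less than d, these
degrees are less than d ^ n, and they determine m, being numbers written in base
d.  So the monomial of largest degree cannot be cancelled, and a polynomial
which is non-zero modulo s remains so on the curve, whatever the constants c. *)
Lemma exists_nonzero_on_curve (s : Spec R) d (f : mpoly n R) (c : 'I_n -> R)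
    (r : nat -> R) :
  f \notin generic_point n s -> exponents_lt d f ->
  distinct_residues s (d ^ n) r ->
  exists k, mpoly.meval (fun i => r k ^+ (d ^ i) + c i) f \notin s.
Proof.
move=> /generic_pointPn[m0 fm0] fd rP.
pose h (i : 'I_n) : {poly R} := 'X^(d ^ i) + (c i)%:P.
pose F : {rmorphism mpoly n R -> {poly R}} := mpoly.mmap (@polyC R) h.
have evalF t p : (F p).[t] = mpoly.meval (fun i => t ^+ (d ^ i) + c i) p.
  rewrite -horner_evalE; apply: (eq_mpoly_morph (f := horner_eval t \o F)
    (g := mpoly.meval (fun i => t ^+ (d ^ i) + c i))) => [a|i] /=.
    by rewrite mpoly.mmapC mpoly.mevalC horner_evalE hornerC.
  by rewrite mmap_mvar mpoly.mevalXU horner_evalE /h !hornerE.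
have msuppF m : mpoly.mcoeff m f \notin s -> m \in mpoly.msupp f.
  move=> fm; rewrite mpoly.mcoeff_msupp; apply: contraNneq fm => ->.
  exact: idealr0.
pose e m := (\sum_(i < n) mpoly.fun_of_multinom m i * d ^ i)%N.
have hP m : monic_size (e m) (mpoly.mmap1 h m).
  apply: monic_size_prod => i; apply: monic_size_exp; apply: monic_size_XnaddC.
  by rewrite expn_gt0 (leq_ltn_trans _ (fd m0 (msuppF _ fm0) i)).
have e_lt m : m \in mpoly.msupp f -> (e m < d ^ n)%N.
  by move=> mf; apply: digits_lt => i; apply: fd.
have F_E : F f = \sum_(m <- mpoly.msupp f)
    (mpoly.mcoeff m f)%:P * mpoly.mmap1 h m by [].
pose P k :=
  has (fun m => (mpoly.mcoeff m f \notin s) && (e m == k)) (mpoly.msupp f).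
(* m is the monomial of largest degree on the curve, among those whose
   coefficient is not in s. *)
have exP : exists k, P k.
  by exists (e m0); apply/hasP; exists m0; rewrite ?msuppF // fm0 eqxx.
have boundP k : P k -> (k <= d ^ n)%N.
  by move=> /hasP[m mf /andP[_ /eqP <-]]; rewrite ltnW // e_lt.
have [k /hasP[m mf /andP[fm /eqP <-{k}]] kmax] := ex_maxnP exP boundP.
have sizeF : (size (F f) <= d ^ n)%N.
  rewrite F_E big_seq.
  apply: (big_ind (fun G : {poly R} => (size G <= d ^ n)%N)).
  - by rewrite size_poly0.
  - by move=> G G' Gd G'd; rewrite (leq_trans (size_polyD _ _)) // geq_max Gd.
  - move=> m' m'f; apply: leq_trans (size_polyMleq _ _) _.
    rewrite (hP m').2 addnS /= (leq_trans _ (e_lt _ m'f)) // -addn1 addnC.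
    by rewrite leq_add2l size_polyC leq_b1.
have coefF : (F f)`_(e m) \notin s.
  rewrite F_E coef_sum (bigD1_seq m) ?mpoly.msupp_uniq //=.
  have [hm1 hm2] := hP m.
  have -> : ((mpoly.mcoeff m f)%:P * mpoly.mmap1 h m)`_(e m) = mpoly.mcoeff m f.
    by rewrite coefCM -[e m]/(e m).+1.-1 -hm2 -lead_coefE (monicP hm1) mulr1.
  apply: contra fm; set S := bigop _ _ _ => Hs.
  rewrite -[mpoly.mcoeff m f](addrK S); apply: rpredB => //.
  rewrite /S big_seq_cond; apply: rpred_sum => m' /andP[m'f m'm].
  rewrite coefCM; have [fm's|fm's] := boolP (mpoly.mcoeff m' f \in s).
    by rewrite mulrC idealMr.
  rewrite nth_default ?mulr0 ?idealr0 // (hP m').2 ltn_neqAle kmax ?andbT.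
    apply: contraNneq m'm => /digits_inj ee; apply/eqP/mpoly.mnmP.
    by apply: ee => i; apply: fd.
  by apply/hasP; exists m'; rewrite // fm's eqxx.
have [k] := exists_nonroot sizeF coefF rP.
by rewrite evalF; exists k.
Qed.

End Kronecker.

(** * Fibers of patch-closed sets *)

Lemma patch_closed_preimage (A B : comNzRingType) (f : {rmorphism A -> B})
    (T : set (Spec A)) :
  patch_closed T -> patch_closed (spec_map f @^-1` T).
Proof.
move=> clT p /clT[e pe eT]; exists (f e); first by rewrite -mem_spec_map.
by move=> q /eT eq pq; rewrite -mem_spec_map; apply: eq => x; apply: pq.
Qed.

Section Fibers.
Variables (R : comNzRingType) (n : nat).
Hypothesis noethR : noetherian R.
Implicit Types (s : Spec R) (T : set (Spec (mpoly n R))).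

(** If the generic point of the fiber over p is not in T, some polynomial e
belongs to all the points of T in its closure, and has a coefficient h outside
p.  A prime s above p whose fiber is generically in T contains all the
coefficients of e, hence it contains h. *)
Lemma full_fibers_finite T : patch_closed T ->
  (forall s, T (generic_point n s) -> maximal_prime s) ->
  exists X : seq (Spec R), (forall s, s \in X -> maximal_prime s) /\
    forall s, T (generic_point n s) -> s \in X.
Proof.
move=> clT Tmax.
suff [X [Xmax XP]] : exists X : seq (Spec R),
    (forall s, s \in X -> maximal_prime s) /\
    forall s, setT s -> T (generic_point n s) -> s \in X.
  by exists X; split=> // s; apply: XP.
apply: (@spec_ind _ (fun S => exists X : seq (Spec R),
    (forall s, s \in X -> maximal_prime s) /\
    forall s, S s -> T (generic_point n s) -> s \in X) noethR)
    => [A B AB [X [Xm XP]]||A B [X [Xm XP]] [Y [Ym YP]]|p].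
- by exists X; split=> // q /AB; apply: XP.
- by exists [::].
- exists (X ++ Y); split=> [s|s [/XP Xs|/YP Ys] Ts]; rewrite mem_cat.
  + by move=> /orP[/Xm|/Ym].
  + by rewrite Xs.
  + by rewrite Ys ?orbT.
- have [Tp|/clT[e /generic_pointPn[m em] eT]] :=
      pselect (T (generic_point n p)).
    exists 1; first by rewrite idealr1.
    exists [:: p]; split=> [q|q [/(maximal_prime_eq (Tmax p Tp)) ->]].
      by rewrite inE => /eqP ->; apply: Tmax.
    by rewrite inE.
  exists (mpoly.mcoeff m e) => //; exists [::]; split=> // s [ps /negP es] Ts.
  exfalso; apply: es; apply: (mem_generic_point _ _).1.
  apply: eT => // f /mem_generic_point fp.
  by apply/mem_generic_point => k; apply/ps.
Qed.

(** Near the generic point of an irreducible closed set, a single polynomial e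
does for all the fibers; finitely many pieces give a finite bound d. *)
Lemma fibers_bounded_degree T (L : seq (Spec R)) : patch_closed T ->
  (forall s, s \in L -> maximal_prime s) ->
  (forall s, s \notin L -> ~ T (generic_point n s)) ->
  exists d, forall s, s \notin L -> exists f, [/\ f \notin generic_point n s,
    exponents_lt d f & forall q, T q -> structure_map q = s -> f \in q].
Proof.
move=> clT Lmax LT.
suff [d dP] : exists d, forall s, setT s -> s \notin L ->
    exists f, [/\ f \notin generic_point n s,
    exponents_lt d f & forall q, T q -> structure_map q = s -> f \in q].
  by exists d => s; apply: dP.
apply: (@spec_ind _ (fun S => exists d, forall s, S s -> s \notin L ->
    exists f, [/\ f \notin generic_point n s,
    exponents_lt d f & forall q, T q -> structure_map q = s -> f \in q]) noethR)
    => [A B AB [d dP]||A B [d dP] [d' d'P]|p].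
- by exists d => s /AB; apply: dP.
- by exists 0%N.
- exists (maxn d d') => s [/dP H|/d'P H] /H[f [fs fd fT]];
    exists f; split=> // m mf i.
    by rewrite leq_max fd.
  by rewrite leq_max fd // orbT.
- have [pL|pL] := boolP (p \in L).
    exists 1; first by rewrite idealr1.
    by exists 0%N => s [/(maximal_prime_eq (Lmax p pL)) <-]; rewrite pL.
  have [e ep eT] := clT _ (LT p pL); have [m em] := generic_pointPn ep.
  have [d ed] := exists_exponents_lt e.
  exists (mpoly.mcoeff m e) => //; exists d => s [ps es] _.
  exists e; split=> //.
    by apply: contra es => /mem_generic_point.
  move=> q Tq qs; apply: eT => // f /mem_generic_point fp.
  apply: (@generic_point_sub _ _ s); first by rewrite qs.
  by apply/mem_generic_point => k; apply/ps.
Qed.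

End Fibers.

(** * Chains of points *)

Fixpoint chain_from (A : comNzRingType) (T : set (Spec A)) k p : Prop :=
  if k is k'.+1 then
    T p /\ exists q : Spec A,
      [/\ {subset p <= q}, ~ {subset q <= p} & chain_from T k' q]
  else T p.

Lemma chain_from_mem (A : comNzRingType) (T : set (Spec A)) k p :
  chain_from T k p -> T p.
Proof. by case: k => [|k []]. Qed.

Lemma chain_from_sub (A : comNzRingType) (S T : set (Spec A)) k p :
  S `<=` T -> chain_from S k p -> chain_from T k p.
Proof.
move=> ST; elim: k p => [|k IH] p; first exact: ST.
by move=> [/ST Tp [q [pq nqp /IH qchain]]]; split=> //; exists q.
Qed.

(** * Hypersurfaces isomorphic to an affine space *)

Section Graph.
Variables (R : comNzRingType) (n : nat).

Definition extend (S : Type) (z : S) (y : 'I_n -> S) (i : 'I_n.+1) : S :=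
  if unlift ord_max i is Some j then y j else z.

Lemma extend_max (S : Type) (z : S) y : extend z y ord_max = z.
Proof. by rewrite /extend unlift_none. Qed.

Lemma extend_lift (S : Type) (z : S) y j : extend z y (lift ord_max j) = y j.
Proof. by rewrite /extend liftK. Qed.

Variables (g : mpoly n R) (a : R).

(** On spectra, the embedding of the affine space of dimension n as the graph
of g + a. *)
Definition graph_morph : {rmorphism mpoly n.+1 R -> mpoly n R} :=
  mpoly.mmap (@mpolyC n R) (extend (g + mpolyC n a) (fun i => mvar i)).

Definition lift_vars : {rmorphism mpoly n R -> mpoly n.+1 R} :=
  mpoly.mmap (@mpolyC n.+1 R) (fun i => mvar (lift ord_max i)).

Definition graph (q : Spec (mpoly n R)) : Spec (mpoly n.+1 R) :=
  spec_map graph_morph q.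

Lemma mem_graph q f : (f \in graph q) = (graph_morph f \in q).
Proof. by []. Qed.

Lemma graph_morphC c : graph_morph (mpolyC n.+1 c) = mpolyC n c.
Proof. by rewrite /graph_morph /= mpoly.mmapC. Qed.

Lemma lift_varsK f : graph_morph (lift_vars f) = f.
Proof.
apply: (eq_mpoly_morph (f := graph_morph \o lift_vars)
  (g := idfun)) => [c|i] /=.
  by rewrite /graph_morph /lift_vars /= !mpoly.mmapC.
by rewrite /graph_morph /lift_vars /= !mmap_mvar extend_lift.
Qed.

Lemma graph_sub p q : {subset graph p <= graph q} -> {subset p <= q}.
Proof.
move=> pq f; rewrite -{1}[f]lift_varsK -mem_graph => /pq.
by rewrite mem_graph lift_varsK.
Qed.

Lemma structure_map_graph q : structure_map (graph q) = structure_map q.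
Proof.
by apply: spec_eq => x; rewrite !mem_structure_map mem_graph graph_morphC.
Qed.

Lemma graph_equation q : mvar ord_max - lift_vars g - mpolyC n.+1 a \in graph q.
Proof.
rewrite mem_graph !rmorphB lift_varsK graph_morphC.
rewrite [graph_morph (mvar _)]mmap_mvar extend_max.
by rewrite addrAC addrK subrr idealr0.
Qed.

Lemma graph_rat_point c s :
  graph (rat_point c s) = rat_point (extend (mpoly.meval c g + a) c) s.
Proof.
apply: spec_eq => f; rewrite mem_graph !mem_rat_point; congr (_ \in s).
apply: (eq_mpoly_morph (f := mpoly.meval c \o graph_morph)
  (g := mpoly.meval (extend (mpoly.meval c g + a) c))) => [b|i] /=.
  by rewrite /graph_morph /= mpoly.mmapC !mpoly.mevalC.
rewrite /graph_morph /= mmap_mvar mpoly.mevalXU.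
have [j ->|->] := unliftP ord_max i.
  by rewrite !extend_lift mpoly.mevalXU.
by rewrite !extend_max rmorphD /= mpoly.mevalC.
Qed.

End Graph.

(** * Induction on the dimension of the affine space *)

Section Avoidance.
Variables (R : comNzRingType) (m : nat).
Hypothesis noethR : noetherian R.

Definition over_compl n (L : seq (Spec R)) : set (Spec (mpoly n R)) :=
  [set q | structure_map q \notin L].

(** The list Y is free: it serves to make the residue rings outside L' as large
as is needed for the fibers of the cut to miss a rational point.  The value of a
is imposed by L', so that the graph contains, over each member of L', the point
which avoids T, and by the minimal points of the T_i, none of which may lie on
the graph.  A chain in the cut can then be extended by a minimal point. *)
Lemma hypersurface_step n (T : 'I_m -> set (Spec (mpoly n.+1 R)))
    (L Y : seq (Spec R)) (g : mpoly n R) :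
  (forall i, patch_closed (T i)) ->
  (forall s, s \in L -> maximal_prime s) ->
  (forall s, s \in Y -> maximal_prime s) ->
  (forall i p, ~ chain_from (T i `&` @over_compl n.+1 L) n.+1 p) ->
  (forall s, maximal_prime s -> exists c, forall i, ~ T i (rat_point c s)) ->
  exists (a : R) (L' : seq (Spec R)),
    [/\ {subset L <= L'}, {subset Y <= L'},
        forall s, s \in L' -> maximal_prime s,
        forall s, s \in L' ->
          exists c, forall i, ~ T i (graph g a (rat_point c s)) &
        forall i q,
          ~ chain_from (graph g a @^-1` T i `&` @over_compl n L') n q].
Proof.
move=> clT Lmax Ymax Tchain Tpoint.
have /choice[X XP] i :=
  patch_closed_basis (noetherian_mpoly (n := n.+1) noethR) (clT i).
pose XX := flatten [seq X i | i <- enum 'I_m].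
have XXP i p : p \in X i -> p \in XX.
  by move=> pX; apply/flattenP; exists (X i); rewrite // map_f // mem_enum.
pose few (p : Spec (mpoly n.+1 R)) :=
  `[< exists c, ~ many_residues (structure_map p) c >].
pose L' := L ++ Y ++ [seq structure_map p | p <- XX & few p].
have L'max s : s \in L' -> maximal_prime s.
  rewrite !mem_cat => /or3P[/Lmax|/Ymax|/mapP[p]] //.
  rewrite mem_filter => /andP[/asboolP[c cP] _] ->.
  exact: few_residues_maximal cP.
have /choice[c cP] (s : Spec R) :
    exists c, maximal_prime s -> forall i, ~ T i (rat_point c s).
  have [/Tpoint[c cP]|nmax] := pselect (maximal_prime s); first by exists c.
  by exists (fun=> 0).
pose c' s i := c s (lift ord_max i).
pose b s := c s ord_max - mpoly.meval (c' s) g.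
have [a0 a0P] := chinese_maximal b L'max.
(* The values of a for which the graph passes through p are congruent to al p
   modulo the prime below p. *)
pose u : mpoly n.+1 R := mvar ord_max - lift_vars R n g.
have /choice[al alP] (p : Spec (mpoly n.+1 R)) : exists al, forall a,
    u - mpolyC n.+1 a \in p -> a - al \in structure_map p.
  have [[al pal]|nex] := pselect (exists al, u - mpolyC n.+1 al \in p).
    exists al => a pa; rewrite mem_structure_map rmorphB /=.
    have -> : mpolyC n.+1 a - mpolyC n.+1 al =
        (u - mpolyC n.+1 al) - (u - mpolyC n.+1 a).
      by rewrite (opprB u) [RHS]addrC subrKA.
    exact: rpredB.
  by exists 0 => a pa; case: nex; exists a.
pose D := [seq (structure_map p, al p) | p <- XX & structure_map p \notin L'].
have [||a [aL' aD]] := @exists_avoid_cosets R L' D a0 L'max.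
- by move=> _ /mapP[p + ->] /=; rewrite mem_filter => /andP[].
- move=> _ /mapP[p + ->] k /=; rewrite mem_filter => /andP[+ pX].
  apply: contraNP => nmany; rewrite !mem_cat; apply/or3P/Or33/map_f.
  by rewrite mem_filter pX andbT; apply/asboolP; exists k.
exists a, L'; split=> //.
- by move=> s sL; rewrite mem_cat sL.
- by move=> s sY; rewrite !mem_cat sY orbT.
- move=> s sL'; exists (c' s) => i; rewrite graph_rat_point.
  have -> : rat_point (extend (mpoly.meval (c' s) g + a) (c' s)) s =
      rat_point (c s) s.
    apply: rat_point_congr => j; have [k ->|->] := unliftP ord_max j.
      by rewrite extend_lift subrr idealr0.
    rewrite extend_max; have -> : mpoly.meval (c' s) g + a - c s ord_max =
        (a - a0) + (a0 - b s).
      by rewrite addrA subrK /b opprB addrA [a + _]addrC.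
    by apply: rpredD; [apply: aL'|apply: a0P].
  exact: cP (L'max s sL') i.
- move=> i q qchain.
  have lift_chain k p :
      chain_from (graph g a @^-1` T i `&` @over_compl n L') k p ->
      chain_from (T i `&` @over_compl n.+1 L) k (graph g a p).
    have mem_lift p' : (graph g a @^-1` T i `&` @over_compl n L') p' ->
        (T i `&` @over_compl n.+1 L) (graph g a p').
      move=> [Tp pL']; split=> //; rewrite /over_compl /= structure_map_graph.
      by apply: contra pL' => pL; rewrite mem_cat pL.
    elim: k p => [|k IH] p; first exact: mem_lift.
    move=> [/mem_lift Tp [p' [pp' np'p /IH p'chain]]]; split=> //.
    exists (graph g a p'); split=> // [x|/graph_sub //].
    by rewrite !mem_graph; apply: pp'.
  have [Tq qL'] := chain_from_mem qchain.
  have [XT /(_ _ Tq)[p pX pq]] := XP i.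
  have pL' : structure_map p \notin L'.
    apply: contra qL' => pL'; rewrite -(structure_map_graph g a q).
    suff <- : structure_map p = structure_map (graph g a q) by [].
    apply: maximal_prime_eq (L'max _ pL') _.
    by move=> x; rewrite !mem_structure_map; apply: pq.
  apply: (Tchain i p); split.
    split; first exact: XT.
    by apply: contra pL' => pL; rewrite mem_cat pL.
  exists (graph g a q); split=> //; last exact: lift_chain.
  move=> /(_ _ (graph_equation g a q))/alP; apply/negP.
  apply: (aD (structure_map p, al p)); apply/mapP; exists p => //.
  by rewrite mem_filter pL' (XXP i).
Qed.

(** A cut is made by the graph of a large power of x_0, except for the last one,
from dimension 1 to dimension 0, when no x_0 is left: the function g is then 0,
and the condition on chains says that no point of T remains over the complement
of L'. *)
Lemma exists_avoiding_point n (T : 'I_m -> set (Spec (mpoly n R)))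
    (L : seq (Spec R)) :
  (forall i, patch_closed (T i)) ->
  (forall s, s \in L -> maximal_prime s) ->
  (forall i p, ~ chain_from (T i `&` @over_compl n L) n p) ->
  (forall i s, s \notin L -> ~ T i (generic_point n s)) ->
  (forall s, maximal_prime s -> exists c, forall i, ~ T i (rat_point c s)) ->
  exists c, forall i s, ~ T i (rat_point c s).
Proof.
elim: n T L => [|n IH] T L clT Lmax Tchain Tgen Tpoint.
  exists (fun=> 0) => i s Ts; have [sL|sL] := boolP (s \in L).
    have [c /(_ i)] := Tpoint s (Lmax s sL); apply.
    by rewrite (_ : c = fun=> 0) //; apply/funext => -[].
  apply: (Tchain i (rat_point (fun=> 0) s)); split=> //.
  by rewrite /over_compl /= structure_map_rat_point.
suff [g [a [L' [L'max L'chain L'gen L'point]]]] : exists g a L',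
    [/\ forall s, s \in L' -> maximal_prime s,
      forall i q, ~ chain_from (graph g a @^-1` T i `&` @over_compl n L') n q,
      forall i s, s \notin L' -> ~ T i (graph g a (generic_point n s)) &
      forall s, exists c, forall i, ~ T i (graph g a (rat_point c s))].
  have [|||||c cP] := IH (fun i => graph g a @^-1` T i) L'.
  - by move=> i; apply: patch_closed_preimage (clT i).
  - exact: L'max.
  - exact: L'chain.
  - exact: L'gen.
  - by move=> s _; apply: L'point.
  exists (extend (mpoly.meval c g + a) c) => i s.
  by rewrite -graph_rat_point; apply: cP.
case: n IH T clT Tchain Tgen Tpoint => [|n] _ T clT Tchain Tgen Tpoint.
  have [//|a [L' [LL' _ L'max L'point L'chain]]] :=
    @hypersurface_step 0 T L [::] 0 clT Lmax _ Tchain Tpoint.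
  exists 0, a, L'; split=> // [i s sL' Ts|s].
    apply: (L'chain i (generic_point 0 s)); split; rewrite //=.
    by rewrite /over_compl /= structure_map_generic_point.
  have [/L'point//|sL'] := boolP (s \in L').
  exists (fun=> 0) => i Ts; apply: (L'chain i (rat_point (fun=> 0) s)).
  by split; rewrite //= /over_compl /= structure_map_rat_point.
have [|d dP] := fibers_bounded_degree noethR (patch_closed_bigcup clT) Lmax.
  by move=> s sL [i _]; apply: Tgen.
have [Y0 Y0P] := few_residues_finite noethR (d ^ n.+2).
pose Y := [seq s <- Y0 | `[< ~ many_residues s (d ^ n.+2) >]].
have YP s : s \notin Y -> many_residues s (d ^ n.+2).
  apply: contraNP => fs; rewrite mem_filter Y0P // andbT; exact/asboolP.
pose g : mpoly n.+1 R := mvar ord0 ^+ (d ^ n.+1).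
have [|a [L' [LL' YL' L'max L'point L'chain]]] :=
    @hypersurface_step n.+1 T L Y g clT Lmax _ Tchain Tpoint.
  move=> s; rewrite mem_filter => /andP[/asboolP fs _].
  exact: few_residues_maximal fs.
(* The curve of exists_nonzero_on_curve with constants (0, ..., 0, a) lies on
   the graph. *)
have key s : s \notin L' -> exists y f, f \notin graph g a (rat_point y s) /\
    forall i q, T i q -> structure_map q = s -> f \in q.
  move=> sL'.
  have [|f [fs fd fT]] := dP s; first by apply: contra sL' => /LL'.
  have [r rP] : many_residues s (d ^ n.+2).
    by apply: YP; apply: contra sL' => /YL'.
  have [k kP] := exists_nonzero_on_curve (extend a (fun=> 0)) fs fd rP.
  set t := r k in kP.
  exists (fun j : 'I_n.+1 => t ^+ (d ^ j)), f; split; last first.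
    by move=> i q Tq; apply: fT; exists i.
  rewrite graph_rat_point mem_rat_point.
  apply: contra kP; rewrite (_ : extend _ _ =
    (fun i => t ^+ (d ^ i) + extend a (fun=> 0) i)) //.
  apply/funext => i; have [j ->|->] := unliftP ord_max i.
    by rewrite !extend_lift addr0 /= /bump leqNgt ltn_ord.
  by rewrite !extend_max /g rmorphXn /= mpoly.mevalXU expn0 expr1.
exists g, a, L'; split=> // [i s sL' Ts|s].
  have [y [f [/negP nf fT]]] := key s sL'; apply: nf.
  have : f \in graph g a (generic_point n.+1 s).
    by apply: fT Ts _; rewrite structure_map_graph structure_map_generic_point.
  rewrite !mem_graph; apply: generic_point_sub.
  by move=> x; rewrite structure_map_rat_point.
have [/L'point//|sL'] := boolP (s \in L').
have [y [f [/negP nf fT]]] := key s sL'; exists y => i Ts; apply: nf.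
by apply: fT Ts _; rewrite structure_map_graph structure_map_rat_point.
Qed.

End Avoidance.

(** * Dimension *)

(** The supremum is the maximum of S if S is bounded, and +oo otherwise. *)
Lemma supremum_nat_ge (S : set nat) (n : nat) : S n ->
  ((n%:Z)%:E <= supremum -oo [set (k%:Z)%:E | k in S])%E.
Proof.
move=> Sn; apply: ge_supremum_Nmem; last by exists n.
have [[b bP]|nb] := pselect (exists b, forall k, S k -> (k <= b)%N).
  have exS : exists k, `[< S k >] by exists n; apply/asboolP.
  have boundS k : `[< S k >] -> (k <= b)%N by move=> /asboolP/bP.
  have [k /asboolP Sk kmax] := ex_maxnP exS boundS.
  exists (k%:Z)%:E; split=> [_ [j Sj <-]|y].
    by rewrite lee_fin lez_nat; apply/kmax/asboolP.
  by apply; exists k.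
exists +oo%E; split=> [x _|[r|//|]]; first exact: leey.
  move=> ub; exfalso; apply: nb; exists `|r|%N => k Sk.
  have : ((k%:Z)%:E <= r%:E)%E by apply: ub; exists k.
  by rewrite lee_fin; lia.
by move=> /(_ _ (ex_intro2 _ _ n Sn erefl)); rewrite leeNy_eq.
Qed.

Section Dimension.
Variables (R : comNzRingType) (A : set (Spec R)).

Let cone (p : Spec R) : set (set_type A) :=
  [set x | {subset p <= (\val x : Spec R)}].

Lemma closed_cone p : closed (cone p).
Proof.
rewrite -openC; exists (~` zero_locus [set x | x \in p]).
  by exists [set x | x \in p].
by apply/seteqP; split=> x.
Qed.

Lemma irreducible_cone p : A p -> irreducible (cone p).
Proof.
move=> Ap; pose x : set_type A := exist _ p (mem_set Ap).
have cone_sub C : closed C -> C x -> cone p `<=` C.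
  rewrite -openC => -[U [E UE] UC] Cx y py; apply: contrapT => nCy.
  have : (~` C) y by [].
  rewrite -UC UE; case=> e Ee; apply/py.
  have : ~ (~` C) x by [].
  by rewrite -UC UE => /contrapT/(_ e Ee).
split=> [|C D cC cD CD]; first by exists x.
have /CD[Cx|Dx] : cone p x by [].
  by left; apply: cone_sub.
by right; apply: cone_sub.
Qed.

Lemma chain_from_dim k p : chain_from A k p -> ((k%:Z)%:E <= subset_dim A)%E.
Proof.
move=> chain; apply: supremum_nat_ge.
suff [Z [ZP _]] : exists Z, irreducible_chain k Z /\ Z k = cone p by exists Z.
elim: k p chain => [|k IH] p /=.
  move=> Ap; exists (fun=> cone p); split=> //; split=> // i _.
  by split; [apply: closed_cone|apply: irreducible_cone].
move=> [Ap [q [pq nqp qchain]]]; have [Z [[ZP Zlt] Zk]] := IH q qchain.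
exists (fun i => if (i <= k)%N then Z i else cone p); split; last first.
  by rewrite ltnn.
split=> i.
  rewrite leq_eqVlt ltnS => /predU1P[->|ik].
    by rewrite ltnn; split; [apply: closed_cone|apply: irreducible_cone].
  by rewrite ik; apply: ZP.
rewrite ltnS leq_eqVlt => /predU1P[->|ik].
  rewrite eqxx ltnn Zk; split=> [x qx y py|]; first exact/qx/pq.
  by move=> /(_ (exist _ p (mem_set Ap))) H; apply: nqp; apply: H => y.
by rewrite ik orbT; apply: Zlt.
Qed.

End Dimension.

(** An ideal which is maximal among the proper ones is prime. *)
Lemma exists_prime_above (R : comNzRingType) (I : set R) : noetherian R ->
  is_ideal I -> ~ I 1 -> exists p : Spec R, forall x, I x -> x \in p.
Proof.
move=> noethR; move: I; apply: noetherian_ideal_ind noethR _ => I idI IH nI1.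
have [[z nIz nz1]|nex] := pselect (exists2 z, ~ I z & ~ adjoin I z 1).
  have [|p pP] := IH _ (adjoin_ideal z idI) (@sub_adjoin _ I z) _ nz1.
    by move=> /(_ z (adjoin_mem z idI)).
  by exists p => x Ix; apply/pP/sub_adjoin.
have [|p pP] := prime_of_set idI nI1; last by exists p => x /pP.
move=> x y Ixy; have [Ix|nIx] := pselect (I x); [by left|right].
have [i Ii [b e]] : adjoin I x 1 by apply: contrapT => n; apply: nex; exists x.
case: idI => _ ID IM; rewrite -[y]mul1r e mulrDl -mulrA mulrC.
by apply: ID; apply: IM.
Qed.

Lemma zero_dim_closed_maximal (R : comNzRingType) (C : set (Spec R)) :
  noetherian R -> closed C -> (subset_dim C <= 0)%E ->
  exists L : seq (Spec R), (forall s, (s \in L) <-> C s) /\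
    forall s, s \in L -> maximal_prime s.
Proof.
move=> noethR /closed_zero_locus[E CE] dimC.
have nochain p q : C p -> C q -> {subset p <= q} -> {subset q <= p}.
  move=> Cp Cq pq; apply: contrapT => nqp.
  have := @chain_from_dim _ C 1 p (conj Cp (ex_intro _ q (And3 pq nqp Cq))).
  by move=> /le_trans/(_ dimC); rewrite lee_fin.
have [|L [LC LP]] := patch_closed_basis noethR (T := C).
  rewrite CE => p /existsNP[x /not_implyP[Ex /negP px]].
  by exists x => // q /(_ x Ex).
have LE s : (s \in L) <-> C s.
  split=> [/LC//|Cs]; have [p pL ps] := LP s Cs.
  suff -> : s = p by [].
  by apply: spec_eq => x; apply/idP/idP; [apply: (nochain p s)|]; auto.
exists L; split=> // s /LE Cs x sx; apply: contrapT => nex.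
have [|q qP] := exists_prime_above noethR (adjoin_ideal x (mem_spec_ideal s)).
  move=> [i /= si [b e]]; apply: nex; exists b.
  by rewrite e [x * b]mulrC addrK.
have sq : {subset s <= q} by move=> y sy; apply/qP/sub_adjoin.
have Cq : C q by move: Cs; rewrite CE => Es e /Es /sq.
have /(nochain s q Cs Cq sq) : x \in q by apply/qP/adjoin_mem/mem_spec_ideal.
by apply/negP.
Qed.

(** * Residue fields and fibers *)

Lemma fraction_mul_denom (D : idomainType) (x : {ratio D}) :
  (\pi_({fraction D})%qT x) * FracField.tofrac x.2 =
    FracField.tofrac x.1 :> {fraction D}.
Proof.
rewrite -[_ * _]/(FracField.mul _ _) !piE.
apply/eqmodP; rewrite /= FracField.equivfE /FracField.mulf.
by rewrite !numden_Ratio ?mulf_neq0 ?oner_neq0 ?denom_ratioP // !mulr1 mulrC.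
Qed.

Section ResidueField.
Variables (R : comNzRingType) (s : Spec R).

Lemma mem_to_residue_field x : (to_residue_field s x == 0) = (x \in s).
Proof. by rewrite /= /= tofrac_eq0 mem_to_residue_domain. Qed.

Lemma residue_field_surj (k : residue_field s) : maximal_prime s ->
  exists x, to_residue_field s x = k.
Proof.
move=> smax.
have surjD (a : residue_domain s) : exists x, to_residue_domain s x = a.
  by exists (repr a); rewrite /= reprK.
elim/quotW: k => k; have [x xk] := surjD k.1; have [y yk] := surjD k.2.
have [|z yz] := smax y; first by rewrite -mem_to_residue_domain yk denom_ratioP.
have yz1 : to_residue_field s y * to_residue_field s z = 1.
  apply/eqP; rewrite eq_sym -subr_eq0 -(rmorph1 (to_residue_field s)).
  by rewrite -rmorphM -rmorphB mem_to_residue_field.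
exists (x * z); rewrite rmorphM -[RHS]mulr1 -yz1 mulrA; congr (_ * _).
by rewrite /= xk yk fraction_mul_denom.
Qed.

End ResidueField.

Section Fiber.
Variables (R : comNzRingType) (n : nat) (s : Spec R).
Let K := residue_field s.
Let toK := to_residue_field s.

(** Over a maximal ideal, the coordinates of a rational point of the fiber lift
to R. *)
Lemma fiber_map_rational (q : Spec (mpoly n K)) : maximal_prime s ->
  rational_point q -> exists c, fiber_map s q = rat_point c s.
Proof.
move=> smax qrat.
have /choice[c cP] (i : 'I_n) : exists c : R,
    to_residue_field q (mvar i) = to_residue_field q (mpolyC n (toK c)).
  have [k ->] := qrat (to_residue_field q (mvar i)).
  by have [c <-] := residue_field_surj k smax; exists c.
exists c; apply: spec_eq => f; rewrite mem_rat_point mem_spec_map.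
rewrite -mem_to_residue_field -(mem_to_residue_field s).
have -> : to_residue_field q (mpoly.map_mpoly toK f) =
    to_residue_field q (mpolyC n (toK (mpoly.meval c f))).
  apply: (eq_mpoly_morph
    (f := to_residue_field q \o mpoly.map_mpoly toK)
    (g := to_residue_field q \o (@mpolyC n K \o (toK \o mpoly.meval c))))
    => [a|i].
    by rewrite /= mpoly.map_mpolyC mpoly.mevalC.
  rewrite -[LHS]/(to_residue_field q (mpoly.map_mpoly toK (mvar i))).
  rewrite mpoly.map_mpolyX cP.
  rewrite -[RHS]/(to_residue_field q (mpolyC n (toK (mpoly.meval c _)))).
  by rewrite mpoly.mevalXU.
rewrite (mem_to_residue_field q); apply/idP/idP => [qk|/eqP ->]; last first.
  by rewrite /= rmorph0 idealr0.
apply: contraTT qk => nz; apply/negP => qk.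
have := idealMr (mpolyC n (toK (mpoly.meval c f))^-1) qk.
by rewrite /= -rmorphM mulVf // rmorph1 idealr1.
Qed.

End Fiber.

Section Specialize.
Variables (n : nat).

Definition specialize (A : comNzRingType) (c : 'I_n -> A) j :
    {rmorphism mpoly n A -> mpoly n A} :=
  mpoly.mmap (@mpolyC n A)
    (fun i : 'I_n => if (i < j)%N then mpolyC n (c i) else mvar i).

Section Ring.
Variables (A : comNzRingType) (c : 'I_n -> A).

Lemma specializeC j a : specialize c j (mpolyC n a) = mpolyC n a.
Proof. exact: mpoly.mmapC. Qed.

Lemma specializeX j i :
  specialize c j (mvar i) = if (i < j)%N then mpolyC n (c i) else mvar i.
Proof. exact: mmap_mvar. Qed.

Lemma specialize_specialize j k f : (j <= k)%N ->
  specialize c k (specialize c j f) = specialize c k f.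
Proof.
move=> jk; apply: (eq_mpoly_morph (f := specialize c k \o specialize c j)
  (g := specialize c k)) => [a|i];
  rewrite -[LHS]/(specialize c k (specialize c j _)).
  by congr (specialize c k _); apply: specializeC.
have [ij|ij] := boolP (i < j)%N.
  have e : specialize c k (mvar i) = mpolyC n (c i).
    by rewrite specializeX (leq_trans ij).
  rewrite [RHS]e -[RHS](specializeC k); congr (specialize c k _).
  by rewrite specializeX ij.
by congr (specialize c k _); rewrite specializeX (negPf ij).
Qed.

Lemma meval_specialize j f : mpoly.meval c (specialize c j f) = mpoly.meval c f.
Proof.
apply: (eq_mpoly_morph (f := mpoly.meval c \o specialize c j)
  (g := mpoly.meval c)) => [a|i];
  rewrite -[LHS]/(mpoly.meval c (specialize c j _)).
  by rewrite specializeC.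
rewrite specializeX; case: ifP => // _.
by rewrite mpoly.mevalC [RHS]mpoly.mevalXU.
Qed.

Lemma structure_map_specialize j q :
  structure_map (spec_map (specialize c j) q) = structure_map q.
Proof.
apply: spec_eq => x.
by rewrite !mem_structure_map mem_spec_map specializeC.
Qed.

End Ring.

Lemma specialize_map (A B : comNzRingType) (phi : {rmorphism A -> B}) c j f :
  specialize (phi \o c) j (mpoly.map_mpoly phi f) =
    mpoly.map_mpoly phi (specialize c j f).
Proof.
apply: (eq_mpoly_morph (f := specialize (phi \o c) j \o mpoly.map_mpoly phi)
  (g := mpoly.map_mpoly phi \o specialize c j)) => [a|i];
  rewrite -[LHS]/(specialize (phi \o c) j (mpoly.map_mpoly phi _))
          -[RHS]/(mpoly.map_mpoly phi (specialize c j _)).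
  by rewrite mpoly.map_mpolyC !specializeC mpoly.map_mpolyC.
rewrite mpoly.map_mpolyX !specializeX.
by case: ifP => _; rewrite ?mpoly.map_mpolyC ?mpoly.map_mpolyX.
Qed.

End Specialize.

Section FullFiber.
Variables (R : comNzRingType) (n : nat) (s : Spec R) (K : fieldType).
Variable toK : {rmorphism R -> K}.
Hypothesis toKE : forall x, (toK x == 0) = (x \in s).
Let to_fiber (q : Spec (mpoly n K)) : Spec (mpoly n R) :=
  spec_map (mpoly.map_mpoly toK) q.

(** A constructible subset of the fiber which contains the generic point
contains the locus where some non-zero h does not vanish. As s has infinitely
many residues, h is non-zero at some point c with coordinates in R. The chain
consists of the generic points of the linear subspaces x_0 = c_0, ..., x_(j-1) =
c_(j-1), for j = 0, ..., n: each of them specializes to c, so h does not vanish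
there. *)
Lemma full_fiber_chain (T : set (Spec (mpoly n R))) :
  constructible (to_fiber @^-1` (structure_map @^-1` [set s] `&` T)) ->
  T (generic_point n s) -> (forall c, many_residues s c) ->
  exists p, chain_from (T `&` [set q | structure_map q = s]) n p.
Proof.
move=> [l [U [C [UC Teq]]]] Ts many.
have [s0 s0E] := exists_zero_prime K.
have mapE (f : mpoly n R) :
    (mpoly.map_mpoly toK f \in generic_point n s0) = (f \in generic_point n s).
  apply/idP/idP => /mem_generic_point H; apply/mem_generic_point => m;
    have := H m; by rewrite /= mpoly.mcoeff_map_mpoly s0E toKE.
have gen_map : to_fiber (generic_point n s0) = generic_point n s.
  by apply: spec_eq => f; rewrite mem_spec_map mapE.
have [h hs0 hT] : exists2 h, h \notin generic_point n s0 &
    forall q : Spec (mpoly n K), {subset generic_point n s0 <= q} ->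
      h \notin q -> structure_map (to_fiber q) = s /\ T (to_fiber q).
  have : (to_fiber @^-1` (structure_map @^-1` [set s] `&` T))
      (generic_point n s0).
    by rewrite /= gen_map structure_map_generic_point.
  rewrite Teq => -[i _ [Us0 Cs0]].
  have [[E UE] /closed_zero_locus[F CF]] := UC i.
  move: Us0; rewrite UE => /existsNP[h /not_implyP[Eh /negP hs0]].
  exists h => // q s0q /negP hq.
  suff : (to_fiber @^-1` (structure_map @^-1` [set s] `&` T)) q by [].
  rewrite Teq; exists i => //; split.
    by rewrite /= UE => /(_ h Eh).
  by move: Cs0; rewrite CF => Fs0 x Fx; apply/s0q/Fs0.
have [d hd] := exists_exponents_lt h.
have [r rP] := many (d ^ n)%N.
have rP' : distinct_residues s0 (d ^ n) (fun i => toK (r i)).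
  by move=> i j ij; rewrite s0E -rmorphB toKE; apply: rP.
have [k] := exists_nonzero_on_curve (fun=> 0) hs0 hd rP'.
pose c (i : 'I_n) := r k ^+ (d ^ i).
rewrite (_ : (fun i : 'I_n => _) = toK \o c); last first.
  by apply/funext => i; rewrite addr0 -(rmorphXn toK).
move=> hc.
pose p j := spec_map (specialize c j) (generic_point n s).
pose p0 j := spec_map (specialize (toK \o c) j) (generic_point n s0).
have mem_p j f : (f \in p j) = (specialize c j f \in generic_point n s) by [].
have p_map j : to_fiber (p0 j) = p j.
  by apply: spec_eq => f; rewrite !mem_spec_map -mapE specialize_map.
have gen_le (A : comNzRingType) (t : Spec A) (q : Spec (mpoly n A)) :
    structure_map q = t -> {subset generic_point n t <= q}.
  by move=> <-; apply: generic_point_sub.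
have Tp j : (T `&` [set q | structure_map q = s]) (p j).
  split; last first.
    by rewrite /= structure_map_specialize structure_map_generic_point.
  suff [] : structure_map (to_fiber (p0 j)) = s /\ T (to_fiber (p0 j)).
    by rewrite p_map.
  apply: hT.
    apply: gen_le.
    by rewrite structure_map_specialize structure_map_generic_point.
  rewrite mem_spec_map; apply: contra hc => hp.
  rewrite -(meval_specialize _ j) -mem_rat_point.
  by apply: gen_le hp; rewrite structure_map_rat_point.
suff chain j : (j <= n)%N ->
    chain_from (T `&` [set q | structure_map q = s]) j (p (n - j)%N).
  by exists (p (n - n)%N); apply: chain.
elim: j => [_|j IH jn]; first exact: Tp.
split; first exact: Tp.
exists (p (n - j)%N); split; last by apply: IH; apply: ltnW.
  move=> f fp; suff : specialize c (n - j) f \in generic_point n s by [].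
  rewrite -(@specialize_specialize _ _ c (n - j.+1) (n - j)) ?leq_sub2l //.
  suff : specialize c (n - j.+1) f \in p (n - j)%N by [].
  apply: (gen_le _ s); last exact: fp.
  by rewrite structure_map_specialize structure_map_generic_point.
have ilt : (n - j.+1 < n)%N by rewrite ltn_subrL /= (leq_ltn_trans _ jn).
pose i := Ordinal ilt.
have specX : specialize c (n - j) (mvar i - mpolyC n (c i)) = 0.
  rewrite rmorphB (specializeX _ _ i) (specializeC _ _ (c i)).
  by rewrite ltn_sub2l // subrr.
have specX' : specialize c (n - j.+1) (mvar i - mpolyC n (c i)) =
    mvar i - mpolyC n (c i).
  by rewrite rmorphB (specializeX _ _ i) (specializeC _ _ (c i)) ltnn.
move=> sub.
(* x_i - c_i, with i = n - j - 1, separates the two points. *)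
have p0v : specialize c (n - j) (mvar i - mpolyC n (c i)) \in generic_point n s.
  by rewrite specX idealr0.
have : specialize c (n - j.+1) (mvar i - mpolyC n (c i)) \in generic_point n s.
  exact: sub _ p0v.
rewrite specX' => /mem_generic_point/(_ (mpoly.mnm1 i)).
rewrite mpoly.mcoeffB mpoly.mcoeffXU eqxx mpoly.mcoeffC mpoly.mnm1_eq0.
by rewrite mulr0 subr0 idealr1.
Qed.

End FullFiber.

(** * The avoidance theorem *)

Theorem theorem2p1 (R : comNzRingType) (noethR : noetherian R) (N m : nat)
    (T : 'I_m -> set (affine_space N R))
    (proT : forall i, pro_constructible (T i))
    (generic : exists V : set (Spec R),
      [/\ open V,
          (subset_dim (~` V) <= 0)%E &
          forall i : 'I_m,
            (subset_dim (T i `&` structure_map @^-1` V) < (N%:Z)%:E)%E /\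
            forall s : Spec R, V s -> constructible (fiber (T i) s)])
    (avoid : forall s : Spec R,
      exists q : affine_space N (residue_field s),
        rational_point q /\ ~ fiber (\bigcup_i T i) s q) :
  exists sigma : {rmorphism mpoly.mpoly N R -> R},
    is_section sigma /\ range (spec_map sigma) `&` \bigcup_i T i = set0.
Proof.
have clT i : patch_closed (T i) by apply: pro_constructible_patch_closed.
have [V [openV dimV TV]] := generic.
have [|L [LV Lmax]] := zero_dim_closed_maximal noethR _ dimV.
  by rewrite closedC.
have VE s : V s <-> s \notin L.
  split=> [Vs|sL]; first by apply/negP => /LV.
  by apply: contrapT => nVs; move/negP: sL; apply; apply/LV.
have chainTV i p : ~ chain_from (T i `&` structure_map @^-1` V) N p.
  move=> /chain_from_dim dim_ge; have [dim_lt _] := TV i.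
  by have := le_lt_trans dim_ge dim_lt; rewrite ltxx.
pose TL := \bigcup_i T i `&` over_compl L.
have clTL : patch_closed TL.
  move=> p; have [pL _|pL nTp] := boolP (structure_map p \in L).
    exists 1; first by rewrite idealr1.
    move=> q [_ qL] pq; exfalso; move/negP: qL; apply.
    rewrite -(maximal_prime_eq (Lmax _ pL) (q := structure_map q)) //.
    by move=> x; rewrite !mem_structure_map; apply: pq.
  have [|e pe eT] := patch_closed_bigcup clT (p := p).
    by move=> Tp; apply: nTp; split.
  by exists e => // q [Tq _]; apply: eT.
have [s [[i _ Ts] sL]|X [Xmax XP]] := full_fibers_finite noethR clTL.
  move: sL; rewrite /over_compl /= structure_map_generic_point => sL.
  apply: contrapT => nmax; have /VE Vs := sL; have [_ /(_ s Vs) consT] := TV i.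
  have [|p pchain] := full_fiber_chain (@mem_to_residue_field _ s) consT Ts.
    by move=> c; apply: contrapT => /few_residues_maximal.
  apply: (chainTV i p).
  by apply: chain_from_sub pchain => A [TA As]; split; rewrite //= As.
have [|||||c cP] := @exists_avoiding_point R m noethR N T (L ++ X).
- exact: clT.
- by move=> s; rewrite mem_cat => /orP[/Lmax|/Xmax].
- move=> i p pchain; apply: (chainTV i p).
  apply: chain_from_sub pchain => A [TA].
  by rewrite /over_compl /= mem_cat negb_or => /andP[/VE VA _]; split.
- move=> i s; rewrite mem_cat negb_or => /andP[sL /negP sX] Ts; apply/sX/XP.
  by split; [exists i|rewrite /over_compl /= structure_map_generic_point].
- move=> s smax; have [q [qrat nTq]] := avoid s.
  have [c qc] := fiber_map_rational smax qrat; exists c => i Tc; apply: nTq.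
  rewrite /fiber /= qc; split; first exact: structure_map_rat_point.
  by exists i.
exists (mpoly.meval c); split; first by move=> a; apply: mpoly.mevalC.
by apply/seteqP; split=> // q [[s _ <-] [i _]]; apply: cP.
Qed.
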